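(* Let $m,n\ge1$ be integers, $p\in(1,2]$, and $\kappa=\min\{m,n\}^{(p-1)/p}$. Let $F:\mathbb R^{m\times n}\to\mathbb R$ be differentiable and let $\Delta_1<\infty$, $L>0$, $\sigma>0$ be such that: (1) $F(x_1)-\inf_{x}F(x)\le\Delta_1$; (2) $\|\nabla F(x)-\nabla F(y)\|_{S_1}\le L\|x-y\|_{S_\infty}$ for all $x,y\in\mathbb R^{m\times n}$; (3) $\mathbb E[\nabla f(x,\xi)]=\nabla F(x)$ and $\mathbb E[\|\nabla f(x,\xi)-\nabla F(x)\|_{S_1}^p]\le\sigma^p$ for all $x\in\mathbb R^{m\times n}$. Let $T\in\mathbb N_{\ge1}$. Then the iterates of Muon with constant parameters $$\eta_t\equiv\sqrt{\frac{\Delta_1(1-\beta)}{LT}},\qquad \beta_t\equiv\beta=1-\min\Big\{1,\max\Big\{\Big(\frac{\Delta_1L}{\sigma^2\kappa^2T}\Big)^{\frac{p}{3p-2}},T^{-\frac{p}{2p-1}}\Big\}\Big\}$$ satisfy $$\frac1T\sum_{t=1}^T\mathbb E\big[\|\nabla F(x_t)\|_{S_1}\big]\le9\sqrt{\frac{\Delta_1L}{T}}+14\Big(\min\{m,n\}\frac{\Delta_1L\,\sigma^{\frac{p}{p-1}}}{T}\Big)^{\frac{p-1}{3p-2}}+10\,\frac{\min\{m,n\}^{\frac{p-1}{p}}\sigma}{T^{\frac{p-1}{2p-1}}}.$$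
   Context: $\|\cdot\|_{S_1}$ is the nuclear norm (sum of singular values) and $\|\cdot\|_{S_\infty}$ the spectral norm (largest singular value); $\langle\cdot,\cdot\rangle$ is the Frobenius inner product. The stochastic gradient oracle is a map $(x,\xi)\mapsto\nabla f(x,\xi)\in\mathbb R^{m\times n}$, where $\xi$ is a random variable. Muon (idealised, with exact linear minimisation oracle): given $x_1\in\mathbb R^{m\times n}$, stepsizes $\eta_t$, momentum parameters $\beta_t\in[0,1)$ and independent copies $\xi_1,\xi_2,\dots$ of $\xi$, set $m_0=\nabla f(x_1,\xi_1)$ and, for $t\ge1$, $$m_t=\beta_tm_{t-1}+(1-\beta_t)\nabla f(x_t,\xi_t),\qquad x_{t+1}=x_t+\eta_td_t,\quad d_t\in\arg\min_{\|d\|_{S_\infty}\le1}\langle m_t,d\rangle .$$ *)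

(* Defs.v *)
From HB Require Import structures.
From mathcomp Require Import all_boot all_order all_algebra finmap.
From mathcomp Require Import all_classical all_reals all_analysis.
From mathcomp Require Import polyrcf.

Set Implicit Arguments.
Unset Strict Implicit.
Unset Printing Implicit Defensive.

Import Order.TTheory GRing.Theory Num.Theory numFieldNormedType.Exports.
Local Open Scope classical_set_scope.
Local Open Scope ring_scope.

(* The square roots of the eigenvalues of [A^T *m A], counted with
   multiplicity. Since [A^T *m A] is real symmetric, its characteristic
   polynomial splits over [R], so this list has length [n]; when [m < n] it
   contains [n - m] zeros beyond the [minn m n] singular values of the thin
   SVD, which affect neither the sum nor the maximum below. *)
Definition singular_values (R : realType) (m n : nat) (A : 'M[R]_(m, n)) :
    seq R :=
  let p := char_poly (A^T *m A) in
  flatten [seq nseq (mup a p) (Num.sqrt a) | a <- rootsR p].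

Definition nuclear_norm (R : realType) (m n : nat) (A : 'M[R]_(m, n)) : R :=
  \sum_(s <- singular_values A) s.

Definition spectral_norm (R : realType) (m n : nat) (A : 'M[R]_(m, n)) : R :=
  \big[Num.max/0]_(s <- singular_values A) s.

Definition frob_inner (R : realType) (m n : nat) (A B : 'M[R]_(m, n)) : R :=
  \sum_(i < m) \sum_(j < n) A i j * B i j.

(* For [F] differentiable at [x], this is the matrix representing ['d F x] for
   the Frobenius inner product. *)
Definition grad (R : realType) (m n : nat) (F : 'M[R]_(m, n) -> R)
    (x : 'M[R]_(m, n)) : 'M[R]_(m, n) :=
  \matrix_(i < m, j < n) 'D_(delta_mx i j) F x.

(* Matrices carry their Borel sigma-algebra. *)
HB.instance Definition _ (R : realType) (m n : nat) :=
  Measurable.copy 'M[R]_(m, n) (g_sigma_algebraType (@open 'M[R]_(m, n))).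

Definition mutually_independent (R : realType) (dO dX : measure_display)
    (Omega : measurableType dO) (Xi : measurableType dX)
    (P : probability Omega R) (I : choiceType) (D : set I)
    (X : I -> {RV P >-> Xi}) : Prop :=
  forall J : {fset I}, [set` J] `<=` D ->
  forall B : I -> set Xi, (forall i, measurable (B i)) ->
  P (\bigcap_(i in [set` J]) (X i @^-1` B i)) =
    (\prod_(i <- J) P (X i @^-1` B i))%E.

(* The sigma-algebra generated by [xi 1, ..., xi t]. *)
Definition history (dO dX : measure_display) (Omega : measurableType dO)
    (Xi : measurableType dX) (xi : nat -> Omega -> Xi) (t : nat) :
    set (set Omega) :=
  <<s \bigcup_(s in [set s | (1 <= s <= t)%N])
        g_sigma_algebra_preimage (xi s) >>.

Definition is_lmo (R : realType) (m n : nat) (G d : 'M[R]_(m, n)) : Prop :=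
  spectral_norm d <= 1 /\
  forall d', spectral_norm d' <= 1 -> frob_inner G d <= frob_inner G d'.

(* A trajectory of Muon for one realization [xi 1, xi 2, ...] of the samples.
   Only [xi t], [x t] and [d t] with [1 <= t] are constrained. *)
Record muon_run (R : realType) (m n : nat) (Xi : Type)
    (g : 'M[R]_(m, n) -> Xi -> 'M[R]_(m, n)) (x1 : 'M[R]_(m, n))
    (eta beta : nat -> R) (xi : nat -> Xi)
    (x mom d : nat -> 'M[R]_(m, n)) : Prop := MuonRun {
  muon_x1 : x 1%N = x1;
  muon_mom0 : mom 0%N = g x1 (xi 1%N);
  muon_mom : forall t, (1 <= t)%N ->
    mom t = beta t *: mom t.-1 + (1 - beta t) *: g (x t) (xi t);
  muon_lmo : forall t, (1 <= t)%N -> is_lmo (mom t) (d t);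
  muon_x : forall t, (1 <= t)%N -> x t.+1 = x t + eta t *: d t
}.

(* Main.v *)
Require Import Defs.
From HB Require Import structures.
From mathcomp Require Import all_boot all_order all_algebra finmap.
From mathcomp Require Import all_classical all_reals all_analysis.
From mathcomp Require Import measurable_realfun polyrcf ring lra.
From mathcomp Require complex.

Set Implicit Arguments.
Unset Strict Implicit.
Unset Printing Implicit Defensive.

Import Order.TTheory GRing.Theory Num.Theory numFieldNormedType.Exports.
Local Open Scope classical_set_scope.
Local Open Scope ring_scope.

(** Write [al] for [1 - beta] and [D] for [Delta1 * L / T]. Muon is steepest
descent for the spectral norm, driven by the momentum in place of the gradient.
As [d_t] minimises the inner product with [m_t] over the unit ball, the duality
of the nuclear and the spectral norm turns the descent inequality into

  F x_{t+1} <= F x_t - eta |grad F x_t| + 2 eta |m_t - grad F x_t|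
               + L eta^2 / 2,

where the bars stand for the nuclear norm ([muon_step_decrease]). Summing up
leaves the momentum error to be estimated. By [momentum_error] it consists of

- the first noise, damped geometrically, which costs [sigma / (T * al)] on
  average;
- a drift of size at most [L * eta * beta / al], since consecutive iterates are
  at spectral distance at most [eta];
- the exponential average [N_k] of the later noises, which are centred given the
  past and have a [p]-th moment only.

The last item carries the dimension factor [kappa = r ^ ((p - 1) / p)] with
[r = minn m n]; for [p < 2] this is better than the factor [sqrt r] from a
comparison with the Frobenius norm. It comes from a smoothed nuclear norm

  h A = sup { <A, D> - <D, D> / (4 a) : spectral_norm D <= 1 },

which differs from the nuclear norm by at most [r / (4 a)] and satisfies a
parallelogram inequality ([smoothed_parallelogram]): the symmetric second
difference of [h] along [X] is at most twice the minimum of [a |X|^2] and [|X|],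
hence at most twice [a^(p-1) |X|^p]. Since [h] is a supremum of affine functions,
adding a centred [X] raises its expectation by at most [2 a^(p-1) E|X|^p]
([smoothed_add_centered]). The sample at each step is independent of the current
iterate and of the noise accumulated so far ([history_indep], [integral_fresh]),
so the bound propagates to [E (h N_k) <= 2 (a al)^(p-1) sigma^p]
([acc_noise_smoothed]). Choosing [a] to balance this against [r / (4 a)] gives
[E |N_k| <= 9/4 kappa sigma al^((p-1)/p)] ([acc_noise_le]).

Altogether the average of the gradient norms is at most

  3 sqrt (D / al) + 2 sigma / (T al) + 9/2 kappa sigma al^((p-1)/p),

and the two candidates in the definition of [beta] balance the first and the
second summand, respectively, against the third ([balanced_rate]). When
[Delta1 = 0] the stepsize vanishes, the iterates stay at the minimiser [x1], and
the gradient is zero there.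

Nuclear and spectral norm are defined from the roots of a characteristic
polynomial; [svd], which rests on the spectral theorem for real symmetric
matrices, makes their duality accessible. *)

(** * The Frobenius inner product *)

Section FrobeniusInner.
Variable R : realType.
Implicit Types m n : nat.

Lemma frob_innerE m n (A B : 'M[R]_(m, n)) : frob_inner A B = \tr (A^T *m B).
Proof.
rewrite /frob_inner /mxtrace exchange_big; apply: eq_bigr => j _.
by rewrite mxE; apply: eq_bigr => i _; rewrite mxE.
Qed.

Lemma frob_innerC m n (A B : 'M[R]_(m, n)) : frob_inner A B = frob_inner B A.
Proof. by rewrite !frob_innerE -mxtrace_tr trmx_mul trmxK. Qed.

Lemma frob_innerDl m n (A B C : 'M[R]_(m, n)) :
  frob_inner (A + B) C = frob_inner A C + frob_inner B C.
Proof. by rewrite !frob_innerE linearD /= mulmxDl linearD. Qed.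

Lemma frob_innerZl m n c (A C : 'M[R]_(m, n)) :
  frob_inner (c *: A) C = c * frob_inner A C.
Proof. by rewrite !frob_innerE linearZ /= -scalemxAl linearZ. Qed.

Lemma frob_innerDr m n (C A B : 'M[R]_(m, n)) :
  frob_inner C (A + B) = frob_inner C A + frob_inner C B.
Proof. by rewrite ![frob_inner C _]frob_innerC frob_innerDl. Qed.

Lemma frob_innerZr m n c (C A : 'M[R]_(m, n)) :
  frob_inner C (c *: A) = c * frob_inner C A.
Proof. by rewrite ![frob_inner C _]frob_innerC frob_innerZl. Qed.

Lemma frob_innerNl m n (A C : 'M[R]_(m, n)) :
  frob_inner (- A) C = - frob_inner A C.
Proof. by rewrite -scaleN1r frob_innerZl mulN1r. Qed.

Lemma frob_innerNr m n (A C : 'M[R]_(m, n)) :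
  frob_inner A (- C) = - frob_inner A C.
Proof. by rewrite frob_innerC frob_innerNl frob_innerC. Qed.

Lemma frob_inner0l m n (C : 'M[R]_(m, n)) : frob_inner 0 C = 0.
Proof. by rewrite -(scale0r 0) frob_innerZl mul0r. Qed.

Lemma frob_inner0r m n (C : 'M[R]_(m, n)) : frob_inner C 0 = 0.
Proof. by rewrite frob_innerC frob_inner0l. Qed.

Lemma frob_inner_ge0 m n (A : 'M[R]_(m, n)) : 0 <= frob_inner A A.
Proof. by do 2![apply: sumr_ge0 => ? _]; rewrite -expr2 sqr_ge0. Qed.

Lemma frob_inner_eq0 m n (A : 'M[R]_(m, n)) : frob_inner A A = 0 -> A = 0.
Proof.
move=> /eqP; rewrite psumr_eq0 => [/allP h|i _]; last first.
  by apply: sumr_ge0 => ? _; rewrite -expr2 sqr_ge0.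
apply/matrixP => i j; rewrite mxE; apply/eqP.
have /= := h i (mem_index_enum _); rewrite psumr_eq0 => [/allP k|j' _].
  by have /= := k j (mem_index_enum _); rewrite mulf_eq0 orbb.
by rewrite -expr2 sqr_ge0.
Qed.

Lemma frob_inner_gt0 m n (A : 'M[R]_(m, n)) : A != 0 -> 0 < frob_inner A A.
Proof.
by rewrite lt0r frob_inner_ge0 andbT; apply: contra => /eqP/frob_inner_eq0/eqP.
Qed.

Lemma frob_cauchy_schwarz m n (A B : 'M[R]_(m, n)) :
  frob_inner A B <= Num.sqrt (frob_inner A A) * Num.sqrt (frob_inner B B).
Proof.
have [->|B0] := eqVneq B 0.
  by rewrite frob_inner0r mulr_ge0 ?sqrtr_ge0.
have Bgt := frob_inner_gt0 B0.
rewrite -sqrtrM ?frob_inner_ge0// (le_trans (ler_norm _))// -sqrtr_sqr.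
rewrite ler_wsqrtr//.
have := frob_inner_ge0 (frob_inner B B *: A - frob_inner A B *: B).
rewrite !(frob_innerDl, frob_innerDr, frob_innerNl, frob_innerNr).
rewrite !(frob_innerZl, frob_innerZr) (frob_innerC B A).
set a := frob_inner A A; set b := frob_inner B B in Bgt *.
set c := frob_inner A B.
rewrite (_ : _ + _ = b * (a * b - c ^+ 2)); last by ring.
by rewrite pmulr_rge0// subr_ge0.
Qed.

Lemma frob_inner_trmx m n (A B : 'M[R]_(m, n)) :
  frob_inner A^T B^T = frob_inner A B.
Proof. by rewrite !frob_innerE trmxK mxtrace_mulC -mxtrace_tr trmx_mul trmxK. Qed.

Lemma frob_inner_mull m n k (A : 'M[R]_(m, n)) (B : 'M[R]_(n, k)) C :
  frob_inner (A *m B) C = frob_inner B (A^T *m C).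
Proof. by rewrite !frob_innerE trmx_mul mulmxA. Qed.

Lemma frob_inner_sum_col m n (A B : 'M[R]_(m, n)) :
  frob_inner A B = \sum_j frob_inner (col j A) (col j B).
Proof.
rewrite /frob_inner exchange_big; apply: eq_bigr => j _.
by apply: eq_bigr => i _; rewrite big_ord1 !mxE.
Qed.

End FrobeniusInner.

(** * The spectral theorem for real symmetric matrices *)

Section SpectralTheorem.
Import complex.
Variable R : realType.

(** Over the complex numbers there is an eigenvector [a + b i], with a real
    eigenvalue because [S] is symmetric. Whichever of [a] and [b] is nonzero is
    then a real eigenvector. *)
Lemma symmetric_eigenvector n (S : 'M[R]_n) : (0 < n)%N -> S^T = S ->
  exists (v : 'rV[R]_n) mu, v != 0 /\ v *m S = mu *: v.
Proof.
move=> n0 symS; pose f := [the {rmorphism R -> complex R} of real_complex R].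
have [l /eigenvalueP[v vS v0]] := spectral.eigenvalue_closed (map_mx f S) n0.
pose a : 'rV[R]_n := \row_j complex.Re (v 0 j).
pose b : 'rV[R]_n := \row_j complex.Im (v 0 j).
have E j : \sum_k v 0 k * f (S k j) = l * v 0 j.
  move/matrixP/(_ 0 j): vS; rewrite !mxE => <-.
  by apply: eq_bigr => k _; rewrite mxE.
have [mu [nu El]] : exists mu nu, l = Complex mu nu.
  by case: (l) => mu nu; exists mu, nu.
have Rer : forall (x : complex R) (y : R), complex.Re (x * f y) = complex.Re x * y.
  by move=> [x1 x2] y; rewrite /=; ring.
have Imr : forall (x : complex R) (y : R), complex.Im (x * f y) = complex.Im x * y.
  by move=> [x1 x2] y; rewrite /=; ring.
have ReD : {morph @complex.Re R : x y / x + y >-> x + y} by move=> [? ?] [? ?].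
have ImD : {morph @complex.Im R : x y / x + y >-> x + y} by move=> [? ?] [? ?].
have aS : a *m S = mu *: a - nu *: b.
  apply/rowP => j; rewrite !mxE; transitivity (complex.Re (l * v 0 j)).
    rewrite -E (big_morph _ ReD erefl).
    by apply: eq_bigr => k _; rewrite Rer mxE.
  by rewrite El; case: (v 0 j).
have bS : b *m S = nu *: a + mu *: b.
  apply/rowP => j; rewrite !mxE; transitivity (complex.Im (l * v 0 j)).
    rewrite -E (big_morph _ ImD erefl).
    by apply: eq_bigr => k _; rewrite Imr mxE.
  by rewrite El; case: (v 0 j) => x y /=; ring.
have ab0 : (a != 0) || (b != 0).
  rewrite -negb_and; apply: contra v0 => /andP[/eqP a0 /eqP b0].
  apply/eqP/rowP => j; rewrite mxE; move/rowP/(_ j): a0; move/rowP/(_ j): b0.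
  by rewrite !mxE; case: (v 0 j) => x y /= -> ->.
have sym : frob_inner (a *m S) b = frob_inner a (b *m S).
  by rewrite -[LHS]frob_inner_trmx trmx_mul symS frob_inner_mull -trmx_mul
             frob_inner_trmx.
(* [nu * (|a|^2 + |b|^2) = 0] by symmetry of [S]. *)
have nu0 : nu = 0.
  move: sym; rewrite aS bS frob_innerDl frob_innerDr frob_innerNl.
  rewrite !frob_innerZl !frob_innerZr => h.
  have {h} : nu * (frob_inner a a + frob_inner b b) = 0 by lra.
  move/eqP; rewrite mulf_eq0 => /orP[/eqP//|/eqP h].
  have := frob_inner_ge0 a; have := frob_inner_ge0 b.
  by case/orP: ab0 => /frob_inner_gt0; lra.
rewrite nu0 !scale0r subr0 in aS; rewrite nu0 !scale0r add0r in bS.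
by case/orP: ab0; [exists a, mu|exists b, mu].
Qed.

(** The reflection in the hyperplane orthogonal to [v - e], or the identity when
    [v] and [e] agree. *)
Lemma householder n (e v : 'rV[R]_n) : e *m e^T = 1%:M -> v *m v^T = 1%:M ->
  exists H : 'M[R]_n, [/\ H^T = H, H *m H = 1%:M & e *m H = v].
Proof.
move=> e1 v1; have [->|ve] := eqVneq v e.
  by exists 1%:M; rewrite trmx1 !mulmx1.
have [u uE] : exists u, u = v - e by exists (v - e).
have uT : u *m u^T = (frob_inner u u)%:M.
  rewrite -frob_inner_trmx frob_innerE trmxK.
  by rewrite [in LHS](mx11_scalar (u *m u^T)) /mxtrace big_ord1.
set q := frob_inner u u in uT.
have q0 : 0 < q by rewrite frob_inner_gt0// uE subr_eq0.
have qE : q%:M = 2%:M - 2 *: (e *m v^T) :> 'M[R]_1.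
  have veT : v *m e^T = e *m v^T.
    by apply/matrixP => i j; rewrite !ord1 !mxE; apply: eq_bigr => k _;
       rewrite !mxE mulrC.
  rewrite -uT uE linearB /= mulmxBl !mulmxBr e1 v1 veT.
  by apply/matrixP => i j; rewrite !ord1 !mxE /=; ring.
pose H := 1%:M - (2 / q) *: (u^T *m u); exists H.
have uuuu : (u^T *m u) *m (u^T *m u) = q *: (u^T *m u).
  by rewrite mulmxA -(mulmxA u^T) uT mul_mx_scalar -scalemxAl.
split.
- by rewrite /H linearB /= linearZ /= trmx1 trmx_mul trmxK.
- rewrite /H mulmxBl !mulmxBr !mul1mx mulmx1 -scalemxAl -scalemxAr uuuu !scalerA.
  rewrite (_ : 2 / q * (2 / q) * q = 2 / q + 2 / q); last by field; rewrite gt_eqF.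
  by rewrite scalerDl opprD opprK; apply/matrixP => i j; rewrite !mxE; ring.
- rewrite /H mulmxBr mulmx1 -scalemxAr mulmxA.
  have -> : e *m u^T = (- (q / 2))%:M.
    rewrite uE linearB /= mulmxBr e1.
    apply/matrixP => i j; move/matrixP/(_ i j): qE; rewrite !ord1 !mxE/=.
    by rewrite !mulr1n; lra.
  rewrite mul_scalar_mx scalerA mulrN scaleNr opprK.
  rewrite (_ : 2 / q * (q / 2) = 1); last by field; rewrite gt_eqF.
  by rewrite scale1r uE addrC subrK.
Qed.

(** A reflection taking the first basis vector to a unit eigenvector conjugates
    [S] to a block diagonal matrix, to whose second block induction applies. *)
Theorem real_spectral n (S : 'M[R]_n) : S^T = S ->
  exists (Q : 'M[R]_n) (d : 'rV[R]_n), Q *m Q^T = 1%:M /\ S = Q^T *m diag_mx d *m Q.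
Proof.
elim: n S => [|n IH] S symS.
  by exists 1%:M, 0; split; apply/matrixP => -[].
have [w [mu [w0 wS]]] := symmetric_eigenvector (ltn0Sn n) symS.
pose v := (Num.sqrt (frob_inner w w))^-1 *: w.
have vS : v *m S = mu *: v by rewrite -scalemxAl wS !scalerA mulrC.
have v1 : v *m v^T = 1%:M.
  rewrite [LHS]mx11_scalar; congr (_%:M).
  transitivity (frob_inner v v).
    by rewrite -frob_inner_trmx frob_innerE trmxK /mxtrace big_ord1.
  rewrite frob_innerZl frob_innerZr mulrA -expr2 exprVn sqr_sqrtr.
    by rewrite mulVf// gt_eqF// frob_inner_gt0.
  exact: frob_inner_ge0.
pose e : 'rV[R]_(1 + n) := row_mx 1%:M 0.
have e1 : e *m e^T = 1%:M.
  by rewrite /e tr_row_mx mul_row_col trmx0 mulmx0 addr0 trmx1 mulmx1.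
have [H [HT HH eH]] := householder e1 v1.
pose B : 'M[R]_(1 + n) := H *m S *m H.
have symB : B^T = B by rewrite /B !trmx_mul HT symS mulmxA.
have eB : e *m B = mu *: e.
  by rewrite /B !mulmxA eH vS -scalemxAl -eH -mulmxA HH mulmx1.
have ulB : ulsubmx B = mu%:M.
  move: eB; rewrite -{1}(submxK B) /e mul_row_block !mul1mx !mul0mx !addr0.
  by rewrite scale_row_mx => /eq_row_mx[-> _]; rewrite scalemx1.
have urB : ursubmx B = 0.
  move: eB; rewrite -{1}(submxK B) /e mul_row_block !mul1mx !mul0mx !addr0.
  by rewrite scale_row_mx => /eq_row_mx[_ ->]; rewrite scaler0.
have dlB : dlsubmx B = 0 by rewrite -symB -trmx_ursub urB trmx0.
have symC : (drsubmx B)^T = drsubmx B by rewrite trmx_drsub symB.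
have [Q [d [QQ CE]]] := IH _ symC.
pose Q' : 'M[R]_(1 + n) := block_mx 1%:M 0 0 Q.
have QQ' : Q' *m Q'^T = 1%:M.
  rewrite /Q' tr_block_mx mulmx_block !trmx0 !trmx1.
  by rewrite !mulmx0 !mul0mx !mul1mx !addr0 !add0r QQ -scalar_mx_block.
have BE : B = Q'^T *m diag_mx (row_mx mu%:M d) *m Q'.
  rewrite -[LHS]submxK ulB urB dlB CE diag_mx_row /Q' tr_block_mx !mulmx_block.
  rewrite !trmx0 !trmx1 !(mulmx0, mul0mx, mul1mx, mulmx1, addr0, add0r).
  by congr block_mx; apply/matrixP => i j; rewrite !ord1 !mxE eqxx.
have SE : S = H *m B *m H.
  by rewrite /B !mulmxA HH mul1mx -mulmxA HH mulmx1.
exists (Q' *m H), (row_mx mu%:M d); split.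
  by rewrite trmx_mul HT mulmxA -(mulmxA Q') HH mulmx1.
by rewrite SE BE trmx_mul HT !mulmxA.
Qed.

End SpectralTheorem.

(** * Singular values *)

Section SingularValues.
Variable R : realType.

Lemma char_poly_orthogonal n (S Q : 'M[R]_n) (d : 'rV[R]_n) :
  Q *m Q^T = 1%:M -> S = Q^T *m diag_mx d *m Q ->
  char_poly S = \prod_(a <- [seq d 0 i | i : 'I_n]) ('X - a%:P).
Proof.
move=> QQ SE; have QQ' : Q^T *m Q = 1%:M by exact: mulmx1C.
rewrite big_map big_enum.
transitivity (char_poly (diag_mx d)); last first.
  rewrite char_poly_trig ?diag_mx_is_trig//.
  by apply: eq_bigr => i _; rewrite mxE eqxx.
rewrite /char_poly /char_poly_mx.
have -> : 'X%:M - map_mx polyC S =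
    map_mx polyC Q^T *m ('X%:M - map_mx polyC (diag_mx d)) *m map_mx polyC Q.
  rewrite mulmxBr mulmxBl -!map_mxM -SE; congr (_ - _).
  by rewrite mul_mx_scalar -scalemxAl -map_mxM QQ' map_mx1 scalemx1.
rewrite !det_mulmx mulrC mulrA -det_mulmx -map_mxM QQ map_mx1 det1 mul1r.
by [].
Qed.

(** [rootsR] lists each root once; repeating it according to its multiplicity
    recovers the factorisation. *)
Lemma perm_flatten_mup (s : seq R) (p : {poly R}) :
  p = \prod_(a <- s) ('X - a%:P) ->
  perm_eq (flatten [seq nseq (mup a p) a | a <- rootsR p]) s.
Proof.
move=> pE; have p0 : p != 0 by rewrite pE monic_neq0// monic_prod_XsubC.
have U : uniq (rootsR p).
  by have := sorted_roots (- cauchy_bound p) (cauchy_bound p) p;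
     exact: lt_sorted_uniq.
have M x : (x \in rootsR p) = (x \in s).
  by have := roots_on_rootsR p0 x; rewrite in_itv /= pE root_prod_XsubC => <-.
apply/allP => x _ /=; rewrite count_flatten -map_comp sumnE big_map.
under eq_bigr do rewrite /= count_nseq.
rewrite -mu_prod_XsubC -pE; apply/eqP.
have [xs|xs] := boolP (x \in rootsR p).
  rewrite (bigD1_seq x)//= eqxx mul1n big1 ?addn0// => y.
  by move=> /negbTE ->.
rewrite big_seq big1 => [|y ys].
  by rewrite mupNroot// pE root_prod_XsubC -M.
by rewrite /= (negbTE (memPn xs y ys)) mul0n.
Qed.

Lemma perm_singular_values m n (A : 'M[R]_(m, n)) (Q : 'M[R]_n) (d : 'rV[R]_n) :
  Q *m Q^T = 1%:M -> A^T *m A = Q^T *m diag_mx d *m Q ->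
  perm_eq (singular_values A) [seq Num.sqrt (d 0 i) | i : 'I_n].
Proof.
move=> QQ /(char_poly_orthogonal QQ)/perm_flatten_mup/(perm_map (@Num.sqrt R)).
rewrite -[X in perm_eq _ X -> _]map_comp map_flatten -map_comp.
congr (is_true (perm_eq (flatten _) _)).
by apply: eq_map => a /=; rewrite map_nseq.
Qed.

Lemma frob_inner_col m n (A B : 'M[R]_(m, n)) i j :
  frob_inner (col i A) (col j B) = (A^T *m B) i j.
Proof.
by rewrite /frob_inner mxE; apply: eq_bigr => k _; rewrite big_ord1 !mxE.
Qed.

Lemma gram_right_singular m n (A : 'M[R]_(m, n)) (Q : 'M[R]_n) (d : 'rV[R]_n) :
  Q *m Q^T = 1%:M -> A^T *m A = Q^T *m diag_mx d *m Q ->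
  (A *m Q^T)^T *m (A *m Q^T) = diag_mx d.
Proof.
move=> QQ E; rewrite trmx_mul trmxK mulmxA -(mulmxA Q) E !mulmxA QQ mul1mx.
by rewrite -mulmxA QQ mulmx1.
Qed.

(** The rows of [Q] are right singular vectors and [d] holds the squares of the
    singular values, zeros included. *)
Lemma svd m n (A : 'M[R]_(m, n)) : exists (Q : 'M[R]_n) (d : 'rV[R]_n),
  [/\ Q *m Q^T = 1%:M, A^T *m A = Q^T *m diag_mx d *m Q, forall i, 0 <= d 0 i,
      nuclear_norm A = \sum_i Num.sqrt (d 0 i) &
      forall c, 0 <= c ->
        (spectral_norm A <= c) = [forall i, Num.sqrt (d 0 i) <= c]].
Proof.
have [Q [d [QQ E]]] : exists (Q : 'M[R]_n) (d : 'rV[R]_n),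
    Q *m Q^T = 1%:M /\ A^T *m A = Q^T *m diag_mx d *m Q.
  by apply: real_spectral; rewrite trmx_mul trmxK.
have p := perm_singular_values QQ E; exists Q, d; split => //.
- move=> i; have -> : d 0 i = ((A *m Q^T)^T *m (A *m Q^T)) i i.
    by rewrite (gram_right_singular QQ E) mxE eqxx.
  by rewrite -frob_inner_col frob_inner_ge0.
- by rewrite /nuclear_norm (perm_big _ p) big_map big_enum.
- move=> c c0; rewrite /spectral_norm (perm_big _ p) big_map big_enum /=.
  apply/bigmax_leP/forallP => [[_ h] i|h]; first exact: h.
  by split.
Qed.

End SingularValues.

(** * Duality of the nuclear and the spectral norm *)

Section NormDuality.
Variable R : realType.
Implicit Types m n : nat.

Lemma frob_inner_orthogonal m n (A B : 'M[R]_(m, n)) (Q : 'M[R]_n) :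
  Q *m Q^T = 1%:M -> frob_inner (A *m Q^T) (B *m Q^T) = frob_inner A B.
Proof.
move=> /mulmx1C QQ; rewrite !frob_innerE trmx_mul trmxK mxtrace_mulC.
by rewrite mulmxA -(mulmxA _ Q^T) QQ mulmx1 mxtrace_mulC.
Qed.

Lemma frob_inner_cV n (v w : 'cV[R]_n) :
  frob_inner v w = \sum_i v i 0 * w i 0.
Proof. by apply: eq_bigr => i _; rewrite big_ord1. Qed.

Lemma frob_inner_isometry m n (Q : 'M[R]_(m, n)) (v w : 'cV[R]_n) :
  Q^T *m Q = 1%:M -> frob_inner (Q *m v) (Q *m w) = frob_inner v w.
Proof. by move=> QQ; rewrite frob_inner_mull mulmxA QQ mul1mx. Qed.

Lemma frob_inner_gram m n (D : 'M[R]_(m, n)) (Q : 'M[R]_n) d (v : 'cV[R]_n) :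
  D^T *m D = Q^T *m diag_mx d *m Q ->
  frob_inner (D *m v) (D *m v) = \sum_i d 0 i * (Q *m v) i 0 ^+ 2.
Proof.
move=> E; rewrite frob_inner_mull mulmxA E -!mulmxA frob_innerC frob_inner_mull.
rewrite trmxK frob_inner_cV; apply: eq_bigr => i _.
by rewrite mul_diag_mx mxE expr2 mulrA.
Qed.

Lemma spectral_norm_ge0 m n (D : 'M[R]_(m, n)) : 0 <= spectral_norm D.
Proof. exact: bigmax_ge_id. Qed.

(** In the basis of right singular vectors the quadratic form
    [frob_inner (D *m v) (D *m v)] is diagonal, so the largest singular value is
    the operator norm. *)
Lemma spectral_norm_leP m n (D : 'M[R]_(m, n)) c : 0 <= c ->
  reflect (forall v : 'cV[R]_n,
             frob_inner (D *m v) (D *m v) <= c ^+ 2 * frob_inner v v)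
          (spectral_norm D <= c).
Proof.
move=> c0; apply: (iffP idP); have [Q [d [QQ E d0 _ ->//]]] := svd D.
  move=> /forallP h v; rewrite (frob_inner_gram _ E).
  rewrite -(frob_inner_isometry v v (mulmx1C QQ)) frob_inner_cV mulr_sumr.
  apply: ler_sum => i _; rewrite -expr2 ler_wpM2r ?sqr_ge0//.
  by rewrite -[d 0 i]sqr_sqrtr// lerXn2r ?nnegrE ?sqrtr_ge0.
move=> h; apply/forallP => i; rewrite -(ger0_norm c0) -sqrtr_sqr.
have := h (col i Q^T).
rewrite (frob_inner_gram _ E) frob_inner_col trmxK QQ.
have -> : Q *m col i Q^T = col i (Q *m Q^T) by rewrite !colE mulmxA.
rewrite QQ (bigD1 i)//= big1 => [|j ji].
  by rewrite !mxE eqxx mulr1n expr1n !mulr1 addr0 => ?; rewrite ler_wsqrtr.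
by rewrite !mxE (negbTE ji) mulr0n expr0n mulr0.
Qed.

(** In the basis of right singular vectors [v_i] of [A] the inner product is the
    sum of the [<A v_i, D v_i>], where [A v_i] has the [i]-th singular value as
    its length. *)
Lemma nuclear_spectral_duality m n (A D : 'M[R]_(m, n)) :
  frob_inner A D <= nuclear_norm A * spectral_norm D.
Proof.
have [Q [d [QQ E d0 -> _]]] := svd A.
rewrite -(frob_inner_orthogonal A D QQ) frob_inner_sum_col mulr_suml.
apply: ler_sum => i _; rewrite (le_trans (frob_cauchy_schwarz _ _))//.
rewrite [in X in X * _]frob_inner_col (gram_right_singular QQ E) mxE eqxx mulr1n.
rewrite ler_wpM2l ?sqrtr_ge0//.
have /(_ (col i Q^T)) := elimT (spectral_norm_leP D (spectral_norm_ge0 D)) (lexx _).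
rewrite [X in _ <= _ * X]frob_inner_col trmxK QQ !mxE eqxx mulr1.
rewrite (_ : D *m _ = col i (D *m Q^T)); last by rewrite !colE mulmxA.
move=> /ler_wsqrtr/le_trans; apply; rewrite sqrtr_sqr ger0_norm//.
exact: spectral_norm_ge0.
Qed.

(** The dual certificate is the polar factor of [A]. The convention [0^-1 = 0]
    makes it vanish on the kernel of [A]. *)
Lemma nuclear_norm_attained m n (A : 'M[R]_(m, n)) :
  exists2 D, spectral_norm D <= 1 & frob_inner A D = nuclear_norm A.
Proof.
have [Q [d [QQ E d0 -> _]]] := svd A.
pose f : 'rV[R]_n := \row_i (Num.sqrt (d 0 i))^-1.
have W := gram_right_singular QQ E.
exists (A *m Q^T *m diag_mx f *m Q).
  apply/spectral_norm_leP => // v; rewrite expr1n mul1r.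
  have -> : A *m Q^T *m diag_mx f *m Q *m v =
      (A *m Q^T) *m (diag_mx f *m (Q *m v)) by rewrite !mulmxA.
  rewrite frob_inner_mull (mulmxA _^T) W.
  rewrite -(frob_inner_isometry v v (mulmx1C QQ)) !frob_inner_cV.
  move: (Q *m v) => y; apply: ler_sum => i _; rewrite !mul_diag_mx !mxE.
  rewrite (_ : _ * _ = (d 0 i * (Num.sqrt (d 0 i))^-1 ^+ 2) * y i 0 ^+ 2);
    last by ring.
  rewrite -expr2 -[leRHS]mul1r ler_wpM2r ?sqr_ge0//.
  rewrite exprVn sqr_sqrtr//; have [->|di] := eqVneq (d 0 i) 0.
    by rewrite mul0r.
  by rewrite mulfV.
rewrite frob_innerE !mulmxA mxtrace_mulC !mulmxA.
have -> : Q *m A^T *m A *m Q^T = diag_mx d by rewrite -W trmx_mul trmxK !mulmxA.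
rewrite mul_diag_mx /mxtrace; apply: eq_bigr => i _; rewrite !mxE eqxx mulr1n.
rewrite -{1}[d 0 i]sqr_sqrtr// expr2.
have [->|di] := eqVneq (Num.sqrt (d 0 i)) 0; first by rewrite !mul0r.
by rewrite mulfK.
Qed.

Lemma frob_inner_le_nuclear m n (A D : 'M[R]_(m, n)) :
  spectral_norm D <= 1 -> frob_inner A D <= nuclear_norm A.
Proof.
move=> D1; rewrite (le_trans (nuclear_spectral_duality _ _))// ler_piMr//.
have [Q [d [_ _ _ -> _]]] := svd A.
by apply: sumr_ge0 => i _; exact: sqrtr_ge0.
Qed.

Lemma nuclear_norm_ge0 m n (A : 'M[R]_(m, n)) : 0 <= nuclear_norm A.
Proof.
by have [Q [d [_ _ _ -> _]]] := svd A; apply: sumr_ge0 => i _; exact: sqrtr_ge0.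
Qed.

Lemma ler_nuclear_normD m n (A B : 'M[R]_(m, n)) :
  nuclear_norm (A + B) <= nuclear_norm A + nuclear_norm B.
Proof.
have [D D1 <-] := nuclear_norm_attained (A + B).
by rewrite frob_innerDl lerD ?frob_inner_le_nuclear.
Qed.

Lemma spectral_normZ_le m n c (D : 'M[R]_(m, n)) :
  spectral_norm (c *: D) <= `|c| * spectral_norm D.
Proof.
apply/spectral_norm_leP => [|v].
  by rewrite mulr_ge0// spectral_norm_ge0.
rewrite -scalemxAl frob_innerZl frob_innerZr mulrA -expr2 exprMn -[leRHS]mulrA.
rewrite real_normK ?num_real// ler_wpM2l ?sqr_ge0//.
by move: v; apply/(spectral_norm_leP D (spectral_norm_ge0 D)).
Qed.

Lemma spectral_norm0 m n : spectral_norm (0 : 'M[R]_(m, n)) = 0.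
Proof.
apply/eqP; rewrite eq_le spectral_norm_ge0 andbT.
by rewrite -(scale0r 0) (le_trans (spectral_normZ_le _ _))// normr0 mul0r.
Qed.

Lemma spectral_normN_le m n (D : 'M[R]_(m, n)) c :
  spectral_norm D <= c -> spectral_norm (- D) <= c.
Proof.
apply: le_trans; rewrite -scaleN1r (le_trans (spectral_normZ_le _ _))//.
by rewrite normrN1 mul1r.
Qed.

Lemma spectral_norm_midpoint m n (D E : 'M[R]_(m, n)) :
  spectral_norm D <= 1 -> spectral_norm E <= 1 ->
  spectral_norm (2^-1 *: (D + E)) <= 1.
Proof.
move=> /(spectral_norm_leP _ ler01) hD /(spectral_norm_leP _ ler01) hE.
apply/spectral_norm_leP => // v; have := hD v; have := hE v.
rewrite !expr1n !mul1r -scalemxAl mulmxDl.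
have := frob_inner_ge0 (D *m v - E *m v).
rewrite !(frob_innerZl, frob_innerZr, frob_innerDl, frob_innerDr,
  frob_innerNl, frob_innerNr) (frob_innerC (E *m v) (D *m v)).
by lra.
Qed.

Lemma nuclear_normZ_le m n c (A : 'M[R]_(m, n)) :
  nuclear_norm (c *: A) <= `|c| * nuclear_norm A.
Proof.
have [D D1 <-] := nuclear_norm_attained (c *: A).
rewrite frob_innerZl (le_trans (ler_norm _))// normrM ler_wpM2l//.
rewrite ler_norml frob_inner_le_nuclear// andbT lerNl -frob_innerNr.
by rewrite frob_inner_le_nuclear// spectral_normN_le.
Qed.

Lemma nuclear_norm0 m n : nuclear_norm (0 : 'M[R]_(m, n)) = 0.
Proof.
apply/eqP; rewrite eq_le nuclear_norm_ge0 andbT.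
by rewrite -(scale0r 0) (le_trans (nuclear_normZ_le _ _))// normr0 mul0r.
Qed.

Lemma nuclear_normN m n (A : 'M[R]_(m, n)) : nuclear_norm (- A) = nuclear_norm A.
Proof.
have h (B : 'M[R]_(m, n)) : nuclear_norm (- B) <= nuclear_norm B.
  by rewrite -scaleN1r (le_trans (nuclear_normZ_le _ _))// normrN1 mul1r.
by apply/eqP; rewrite eq_le h -{1}[A]opprK h.
Qed.

Lemma frob_inner_gram_trace m n (A : 'M[R]_(m, n)) (Q : 'M[R]_n) d :
  Q *m Q^T = 1%:M -> A^T *m A = Q^T *m diag_mx d *m Q ->
  frob_inner A A = \sum_i d 0 i.
Proof.
move=> QQ E; rewrite frob_innerE E mxtrace_mulC mulmxA QQ mul1mx /mxtrace.
by apply: eq_bigr => i _; rewrite mxE eqxx.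
Qed.

Lemma frob_le_nuclear m n (A : 'M[R]_(m, n)) :
  frob_inner A A <= nuclear_norm A ^+ 2.
Proof.
have [Q [d [QQ E d0 -> _]]] := svd A; rewrite (frob_inner_gram_trace QQ E).
rewrite expr2 mulr_suml; apply: ler_sum => i _.
rewrite -{1}[d 0 i]sqr_sqrtr// expr2 ler_wpM2l ?sqrtr_ge0//.
by rewrite (bigD1 i)//= lerDl sumr_ge0// => j _; exact: sqrtr_ge0.
Qed.

Lemma spectral_le_frob m n (A : 'M[R]_(m, n)) :
  spectral_norm A <= Num.sqrt (frob_inner A A).
Proof.
have [Q [d [QQ E d0 _ ->]]] := svd A; last exact: sqrtr_ge0.
apply/forallP => i; rewrite ler_wsqrtr// (frob_inner_gram_trace QQ E).
by rewrite (bigD1 i)//= lerDl sumr_ge0.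
Qed.

Lemma normr_entry_le_nuclear m n (A : 'M[R]_(m, n)) i j :
  `|A i j| <= nuclear_norm A.
Proof.
rewrite -(ger0_norm (nuclear_norm_ge0 A)) -ler_sqr ?nnegrE ?normr_ge0//.
rewrite !real_normK ?num_real// (le_trans _ (frob_le_nuclear A))//.
rewrite /frob_inner (bigD1 i)//= (bigD1 j)//= -expr2 -addrA lerDl addr_ge0//.
  by apply: sumr_ge0 => k _; rewrite -expr2 sqr_ge0.
by do 2![apply: sumr_ge0 => ? _]; rewrite -expr2 sqr_ge0.
Qed.

(** [|D^T w|^2 = <w, D D^T w> <= |w| |D^T w|]. *)
Lemma contraction_trmx m n (D : 'M[R]_(m, n)) :
  spectral_norm D <= 1 -> spectral_norm D^T <= 1.
Proof.
move=> /(spectral_norm_leP _ ler01) h; apply/spectral_norm_leP => // w.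
rewrite expr1n mul1r; set t := frob_inner _ _.
have [//|] := leP t (frob_inner w w) => wt.
have t0 : 0 < t by rewrite (le_lt_trans (frob_inner_ge0 w)).
have : t <= Num.sqrt (frob_inner w w) * Num.sqrt t.
  rewrite {1}/t frob_inner_mull trmxK (le_trans (frob_cauchy_schwarz _ _))//.
  by rewrite ler_wpM2l ?sqrtr_ge0// ler_wsqrtr// (le_trans (h _))// expr1n mul1r.
rewrite leNgt -{2}(sqr_sqrtr (ltW t0)) expr2 ltr_pM2r ?sqrtr_gt0//.
by rewrite ltr_sqrt// wt.
Qed.

(** The columns of a contraction have length at most one, and so have its rows. *)
Lemma frob_contraction m n (D : 'M[R]_(m, n)) :
  spectral_norm D <= 1 -> frob_inner D D <= (minn m n)%:R.
Proof.
have h p q (E : 'M[R]_(p, q)) : spectral_norm E <= 1 -> frob_inner E E <= q%:R.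
  move=> /(spectral_norm_leP _ ler01) h; rewrite frob_inner_sum_col.
  rewrite -[q in leRHS]card_ord -sum1_card natr_sum; apply: ler_sum => j _.
  rewrite colE (le_trans (h _))// expr1n mul1r -[delta_mx _ _]mul1mx -colE.
  by rewrite frob_inner_col trmx1 mul1mx mxE eqxx.
move=> D1; rewrite natr_min; have [_|_] := leP m%:R n%:R; last exact: h.
by rewrite -frob_inner_trmx h// contraction_trmx.
Qed.

Lemma normr_mx_entry m n (A : 'M[R]_(m, n)) i j : `|A i j| <= `|A|.
Proof.
rewrite [leRHS]/Num.Def.normr /= mx_normrE; apply/bigmax_geP; right => /=.
by exists (i, j).
Qed.

Lemma frob_le_normr m n (A : 'M[R]_(m, n)) :
  frob_inner A A <= (m * n)%:R * `|A| ^+ 2.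
Proof.
have -> : (m * n)%:R * `|A| ^+ 2 = \sum_(i < m) \sum_(j < n) `|A| ^+ 2.
  by rewrite !sumr_const !card_ord -mulrnA mulr_natl mulnC.
apply: ler_sum => i _; apply: ler_sum => j _; rewrite -expr2.
rewrite -real_normK ?num_real// lerXn2r ?nnegrE//.
exact: normr_mx_entry.
Qed.

Lemma sqrt_frob_le_normr m n (A : 'M[R]_(m, n)) :
  Num.sqrt (frob_inner A A) <= Num.sqrt (m * n)%:R * `|A|.
Proof.
rewrite (le_trans (ler_wsqrtr (frob_le_normr A)))//.
by rewrite sqrtrM// sqrtr_sqr normr_id.
Qed.

Lemma nuclear_le_frob m n (A : 'M[R]_(m, n)) :
  nuclear_norm A <= Num.sqrt (minn m n)%:R * Num.sqrt (frob_inner A A).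
Proof.
have [D D1 <-] := nuclear_norm_attained A.
rewrite (le_trans (frob_cauchy_schwarz _ _))// mulrC ler_wpM2r ?sqrtr_ge0//.
by rewrite ler_wsqrtr// frob_contraction.
Qed.

Lemma nuclear_le_normr m n (A : 'M[R]_(m, n)) :
  nuclear_norm A <= Num.sqrt (minn m n)%:R * Num.sqrt (m * n)%:R * `|A|.
Proof.
rewrite (le_trans (nuclear_le_frob A))// -mulrA ler_wpM2l ?sqrtr_ge0//.
exact: sqrt_frob_le_normr.
Qed.

End NormDuality.

(** * The smoothed nuclear norm *)

Section SmoothedNuclearNorm.
Variables (R : realType) (m n : nat) (a : R).
Hypothesis a0 : 0 < a.
Implicit Types A B D E X : 'M[R]_(m, n).

(** The infimal convolution of the nuclear norm and of [a] times the squared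
    Frobenius norm, written in its dual form. *)
Definition smoothed_nuclear_norm A : R :=
  sup [set frob_inner A D - frob_inner D D / (4 * a)
      | D in [set D | spectral_norm D <= 1]].
Local Notation h := smoothed_nuclear_norm.

Let q D := frob_inner D D / (4 * a).

Let q_ge0 D : 0 <= q D.
Proof. by rewrite divr_ge0 ?frob_inner_ge0// mulr_ge0// ltW. Qed.

Lemma smoothed_ge A D : spectral_norm D <= 1 ->
  frob_inner A D - frob_inner D D / (4 * a) <= h A.
Proof.
move=> D1; apply: ub_le_sup; last by exists D.
exists (nuclear_norm A) => _ [E E1 <-].
by have := frob_inner_le_nuclear A E1; have := q_ge0 E; rewrite /q; lra.
Qed.

Lemma smoothed_le A c :
  (forall D, spectral_norm D <= 1 ->
     frob_inner A D - frob_inner D D / (4 * a) <= c) -> h A <= c.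
Proof.
move=> hc; apply: ge_sup => [|_ [D D1 <-]]; last exact: hc.
by eexists; exists 0 => //=; rewrite spectral_norm0.
Qed.

Lemma smoothed_ge0 A : 0 <= h A.
Proof.
have := @smoothed_ge A 0; rewrite spectral_norm0 !frob_inner0r mul0r subr0.
by apply.
Qed.

Lemma smoothed_le_nuclear A : h A <= nuclear_norm A.
Proof.
apply: smoothed_le => D D1; have := frob_inner_le_nuclear A D1.
by have := q_ge0 D; rewrite /q; lra.
Qed.

Lemma nuclear_le_smoothed A : nuclear_norm A <= h A + (minn m n)%:R / (4 * a).
Proof.
have [D D1 <-] := nuclear_norm_attained A.
rewrite -lerBlDr (le_trans _ (smoothed_ge A D1))// lerB//.
by rewrite ler_wpM2r ?invr_ge0 ?mulr_ge0 ?(ltW a0)// frob_contraction.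
Qed.

Lemma smoothedZ_le c A : 0 <= c <= 1 -> h (c *: A) <= c * h A.
Proof.
move=> /andP[c0 c1]; apply: smoothed_le => D D1.
rewrite (le_trans _ (ler_wpM2l c0 (smoothed_ge A D1)))// frob_innerZl mulrBr.
by rewrite lerB// ler_piMl// q_ge0.
Qed.

Lemma smoothed_lipschitz A B : h A - h B <= nuclear_norm (A - B).
Proof.
rewrite lerBlDr; apply: smoothed_le => D D1; rewrite -{1}[A](subrK B) frob_innerDl.
by have := frob_inner_le_nuclear (A - B) D1; have := smoothed_ge B D1; lra.
Qed.

Let pair_bound A X D E : spectral_norm D <= 1 -> spectral_norm E <= 1 ->
  (frob_inner (A + X) D - q D) + (frob_inner (A - X) E - q E) <=
  2 * h A + 2 * Num.min (a * nuclear_norm X ^+ 2) (nuclear_norm X).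
Proof.
move=> D1 E1; have := smoothed_ge A (spectral_norm_midpoint D1 E1).
have XD := frob_inner_le_nuclear X D1.
have XE := frob_inner_le_nuclear X (spectral_normN_le E1).
have X2 := frob_le_nuclear X.
have := frob_inner_ge0 ((4 * a) *: X - (D - E)).
rewrite !(frob_innerDl, frob_innerDr, frob_innerNl, frob_innerNr,
  frob_innerZl, frob_innerZr) in XE *.
rewrite (frob_innerC D X) (frob_innerC E X) (frob_innerC E D) /q.
set s := nuclear_norm X in XD XE X2 *; set xx := frob_inner X X in X2 *.
set dd := frob_inner D D; set ee := frob_inner E E; set de := frob_inner D E.
set xd := frob_inner X D in XD *; set xe := frob_inner X E in XE *.
move=> sq mid.
have qE : forall z, z / (4 * a) = (4 * a)^-1 * z by move=> z; rewrite mulrC.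
rewrite !qE in mid *; set b := (4 * a)^-1 in mid *.
have ab : b * (4 * a) = 1 by rewrite mulVf// mulf_neq0// gt_eqF.
have b0 : 0 < b by rewrite invr_gt0 mulr_gt0.
have dist : 0 <= dd + ee - 2 * de.
  have := frob_inner_ge0 (D - E).
  rewrite !(frob_innerDl, frob_innerDr, frob_innerNl, frob_innerNr).
  by rewrite (frob_innerC E D) -/dd -/ee -/de; lra.
(* Completing the square: [sq] divided by [4 * a]. *)
have sq' : 2 * (xd - xe) - b * (dd + ee - 2 * de) <= 4 * a * xx.
  have : 0 <= b * (4 * a * (4 * a * xx) - 2 * (4 * a * (xd - xe))
               + (dd + ee - 2 * de)).
    by rewrite mulr_ge0 ?(ltW b0)//; move: sq; lra.
  have -> : b * (4 * a * (4 * a * xx) - 2 * (4 * a * (xd - xe))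
      + (dd + ee - 2 * de)) =
    b * (4 * a) * (4 * a * xx) - 2 * (b * (4 * a) * (xd - xe))
      + b * (dd + ee - 2 * de) by ring.
  by rewrite ab; lra.
have pos := mulr_ge0 (ltW b0) dist.
have axs : a * xx <= a * s ^+ 2 by rewrite ler_wpM2l// ltW.
by rewrite /Num.min; case: ifP => _; lra.
Qed.

(** Parallelogram identity for the quadratic term, combined with the convexity
    of the spectral unit ball: [D] and [E] near-optimal at [A + X] and [A - X]
    have a midpoint admissible at [A], and what is left over is
    [frob_inner X (D - E)] minus a multiple of the squared distance of [D] and
    [E]. *)
Lemma smoothed_parallelogram A X : h (A + X) + h (A - X) <=
  2 * h A + 2 * Num.min (a * nuclear_norm X ^+ 2) (nuclear_norm X).
Proof.
rewrite -lerBrDr; apply: smoothed_le => D D1; rewrite lerBrDl -lerBrDr.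
apply: smoothed_le => E E1; rewrite lerBrDr addrC.
exact: pair_bound.
Qed.

(** The first argument of the minimum is the smaller one for [a * s <= 1], the
    second one for [1 <= a * s]; the bound interpolates between the two. *)
Lemma min_square_powR (p s : R) : 1 < p -> p <= 2 -> 0 <= s ->
  Num.min (a * s ^+ 2) s <= a `^ (p - 1) * s `^ p.
Proof.
move=> p1 p2; rewrite le_eqVlt => /predU1P[<-|s0].
  by rewrite ge_min mulr_ge0 ?powR_ge0 ?orbT.
have pE : s `^ p = s `^ (p - 1) * s.
  by rewrite mulrC mulr_powRB1 ?ltW//; lra.
have -> : a `^ (p - 1) * s `^ p = (a * s) `^ (p - 1) * s.
  by rewrite pE powRM ?ltW// mulrA.
have as0 : 0 < a * s by rewrite mulr_gt0.
rewrite ge_min; have [as1|as1] := leP (a * s) 1; apply/orP; [left|right].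
  rewrite expr2 mulrA ler_wpM2r ?(ltW s0)//.
  by apply: ger1_powR; rewrite ?as0//; lra.
rewrite -{1}[s]mul1r ler_wpM2r ?(ltW s0)// -[leLHS](powRr0 (a * s)).
by apply: ler_powR; [exact: ltW|lra].
Qed.

(** The parallelogram inequality with [h (A - X)] replaced by one of the affine
    functions below it. For centred [X] the term [frob_inner X D] averages to
    zero, and the term before it has infimum [- h A] over all [D]. *)
Lemma smoothed_increment (p : R) A X D : 1 < p -> p <= 2 ->
  spectral_norm D <= 1 ->
  h (A + X) <= 2 * h A + 2 * a `^ (p - 1) * nuclear_norm X `^ p
    - (frob_inner A D - frob_inner D D / (4 * a)) + frob_inner X D.
Proof.
move=> p1 p2 D1; have := smoothed_parallelogram A X.
have := smoothed_ge (A - X) D1; rewrite frob_innerDl frob_innerNl.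
by have := min_square_powR p1 p2 (nuclear_norm_ge0 X); lra.
Qed.

End SmoothedNuclearNorm.

(** * Descent for a gradient that is Lipschitz in the dual norm *)

Section Smoothness.
Variables (R : realType) (m n : nat) (F : 'M[R]_(m, n) -> R) (L : R).
Hypothesis hF : forall y : 'M[R]_(m, n), differentiable F y.
Hypothesis hL : 0 <= L.
Hypothesis hLip : forall y z,
  nuclear_norm (grad F y - grad F z) <= L * spectral_norm (y - z).
Implicit Types x y v : 'M[R]_(m, n).

Lemma derive_frob_grad x v : 'D_v F x = frob_inner (grad F x) v.
Proof.
rewrite deriveE// {1}(matrix_sum_delta v) linear_sum /frob_inner /=.
apply: eq_bigr => i _; rewrite linear_sum; apply: eq_bigr => j _ /=.
by rewrite linearZ /= mxE deriveE// mulrC.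
Qed.

Lemma is_derive_line x v (s : R) :
  is_derive s 1 (fun s => F (x + s *: v)) (frob_inner (grad F (x + s *: v)) v).
Proof.
have E : (fun h : R => h^-1 *:
      (((fun s => F (x + s *: v)) \o shift s) (h *: 1) - F (x + s *: v))) =
    (fun h : R => h^-1 *:
      ((F \o shift (x + s *: v)) (h *: v) - F (x + s *: v))).
  apply/funext => h /=; congr (_ *: (F _ - _)).
  by rewrite [h *: (1 : R)]mulr1 scalerDl addrCA.
split; first by rewrite /derivable E; exact: diff_derivable.
by rewrite /derive E -derive_frob_grad.
Qed.

(** The function [psi] along the segment, the difference of [F] and of its
    quadratic majorant, has a nonpositive derivative. *)
Lemma descent x v : F (x + v) <=
  F x + frob_inner (grad F x) v + L / 2 * spectral_norm v ^+ 2.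
Proof.
pose N := spectral_norm v; have N0 : 0 <= N by exact: spectral_norm_ge0.
pose c := frob_inner (grad F x) v.
pose psi (s : R) := F (x + s *: v) - c * s - (L / 2 * N ^+ 2) * s ^+ 2.
pose dpsi (s : R) := frob_inner (grad F (x + s *: v)) v - c - L * N ^+ 2 * s.
have D (s : R) : is_derive s (1 : R) psi (dpsi s).
  have := is_derive_line x v s => Dline.
  apply: (@is_derive_eq _ _ _ ((fun s => F (x + s *: v)) - c *: (id : R -> R)
    - (L / 2 * N ^+ 2) *: ((id : R -> R) ^+ 2))).
  by rewrite /dpsi /GRing.scale /=; field.
have C : {within `[0, 1], continuous psi}.
  apply: continuous_subspaceT => s; apply: differentiable_continuous.
  by apply/derivable1_diffP; have [] := D s.
have [s] := @MVT R psi dpsi 0 1 ltr01 (fun s _ => D s) C.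
rewrite in_itv /= subr0 mulr1 => /andP[s0 _] E.
have : dpsi s <= 0.
  have -> : dpsi s = frob_inner (grad F (x + s *: v) - grad F x) v
                     - L * N ^+ 2 * s.
    by rewrite /dpsi frob_innerDl frob_innerNl.
  rewrite subr_le0 (le_trans (nuclear_spectral_duality _ _))// -/N.
  rewrite (_ : L * N ^+ 2 * s = L * (s * N) * N); last by ring.
  rewrite ler_wpM2r// (le_trans (hLip _ _))// ler_wpM2l// addrC addKr.
  by rewrite (le_trans (spectral_normZ_le _ _))// gtr0_norm.
rewrite -E /psi scale1r scale0r addr0 expr0n !mulr0 expr1n !mulr1 -/c -/N.
by lra.
Qed.

(** Otherwise a short step against the dual certificate of [grad F x] would
    decrease [F]. *)
Lemma grad_eq0_at_min x : (forall y, F x <= F y) -> nuclear_norm (grad F x) = 0.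
Proof.
move=> min; apply/eqP; rewrite eq_le nuclear_norm_ge0 andbT leNgt.
apply/negP => G0; set G := nuclear_norm _ in G0.
have [D D1 GD] := nuclear_norm_attained (grad F x).
have step s : 0 < s -> G <= L / 2 * s.
  move=> s0; have := le_trans (min (x + - s *: D)) (descent x (- s *: D)).
  rewrite frob_innerZr GD -/G.
  have : spectral_norm (- s *: D) ^+ 2 <= s ^+ 2.
    rewrite lerXn2r ?nnegrE ?spectral_norm_ge0 ?(ltW s0)//.
    rewrite (le_trans (spectral_normZ_le _ _))// normrN gtr0_norm//.
    by rewrite ler_piMr// ltW.
  have L2 : 0 <= L / 2 by rewrite divr_ge0.
  move=> /(ler_wpM2l L2) h1 h2; rewrite -(ler_pM2l s0).
  by move: h1 h2; lra.
have := step (G / (L + 1)); rewrite divr_gt0 ?ltr_wpDl// => /(_ isT).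
rewrite mulrCA -{1}[G]mulr1 ler_pM2l// ler_pdivlMr ?ltr_wpDl//.
by move: hL; lra.
Qed.

End Smoothness.

(** * One trajectory of Muon *)

(** The exponential average of the noise from the second step on. Index [k]
    belongs to time [k.+1] and [e k] to time [k.+2], so that the average is empty
    for [k = 0]. *)
Fixpoint noise (R : realType) (m n : nat) (beta : R)
    (e : nat -> 'M[R]_(m, n)) (k : nat) : 'M[R]_(m, n) :=
  if k is k'.+1 then beta *: noise beta e k' + (1 - beta) *: e k' else 0.

Section MuonPath.
Variables (R : realType) (m n : nat) (Xi : Type).
Variables (F : 'M[R]_(m, n) -> R) (L : R).
Hypothesis hF : forall y : 'M[R]_(m, n), differentiable F y.
Hypothesis hL : 0 <= L.
Hypothesis hLip : forall y z,
  nuclear_norm (grad F y - grad F z) <= L * spectral_norm (y - z).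
Variables (g : 'M[R]_(m, n) -> Xi -> 'M[R]_(m, n)) (x1 : 'M[R]_(m, n)).
Variables (eta beta : R) (xi : nat -> Xi) (x mom d : nat -> 'M[R]_(m, n)).
Hypothesis eta0 : 0 <= eta.
Hypothesis beta01 : 0 <= beta < 1.
Hypothesis run : muon_run g x1 (fun=> eta) (fun=> beta) xi x mom d.

Let eps t := g (x t) (xi t) - grad F (x t).

Lemma iterate_step k : spectral_norm (x k.+1 - x k.+2) <= eta.
Proof.
rewrite (muon_x run (ltn0Sn k)) opprD addNKr; apply: spectral_normN_le.
rewrite (le_trans (spectral_normZ_le _ _))// ger0_norm// ler_piMr//.
by have [] := muon_lmo run (ltn0Sn k).
Qed.

(** The momentum error splits into the initial noise, the accumulated later
    noise and a drift caused by the movement of the iterates. *)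
Lemma momentum_error k :
  nuclear_norm (mom k.+1 - grad F (x k.+1)) <=
  beta ^+ k * nuclear_norm (eps 1) +
  nuclear_norm (noise beta (fun k => eps k.+2) k) + L * eta * beta / (1 - beta).
Proof.
have /andP[b0 b1] := beta01; have b1' : 1 - beta != 0 by rewrite subr_eq0 gt_eqF.
have [dr drE drle] : exists2 dr, mom k.+1 - grad F (x k.+1) =
    beta ^+ k *: eps 1 + noise beta (fun k => eps k.+2) k + dr &
    nuclear_norm dr <= L * eta * beta / (1 - beta).
  elim: k => [|k [dr drE drle]].
    exists 0; last first.
      by rewrite nuclear_norm0 divr_ge0 ?mulr_ge0// subr_ge0 ltW.
    rewrite (muon_mom run (ltn0Sn 0)) (muon_mom0 run) (muon_x1 run) /eps (muon_x1 run).
    by rewrite -scalerDl subrKC !scale1r !addr0.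
  exists (beta *: (dr + (grad F (x k.+1) - grad F (x k.+2)))).
    rewrite (muon_mom run (ltn0Sn k.+1)) /=.
    have -> : mom k.+1 = beta ^+ k *: eps 1 + noise beta (fun k => eps k.+2) k
        + dr + grad F (x k.+1) by rewrite -drE subrK.
    by rewrite exprS /eps; apply/matrixP => i j; rewrite !mxE; ring.
  rewrite (le_trans (nuclear_normZ_le _ _))// ger0_norm//.
  rewrite (le_trans (ler_wpM2l b0 (ler_nuclear_normD _ _)))//.
  have h : nuclear_norm (grad F (x k.+1) - grad F (x k.+2)) <= L * eta.
    by rewrite (le_trans (hLip _ _))// ler_wpM2l// iterate_step.
  rewrite (le_trans (ler_wpM2l b0 (lerD drle h)))// le_eqVlt; apply/orP; left.
  by apply/eqP; field.
rewrite drE (le_trans (ler_nuclear_normD _ _))// lerD//.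
rewrite (le_trans (ler_nuclear_normD _ _))// lerD2r.
by rewrite (le_trans (nuclear_normZ_le _ _))// ger0_norm// exprn_ge0.
Qed.

(** Replacing the gradient by the momentum costs the momentum error twice: once
    in the inner product with the direction, once in the norm that this inner
    product attains. *)
Lemma muon_step_decrease k : F (x k.+2) <= F (x k.+1)
  - eta * nuclear_norm (grad F (x k.+1))
  + 2 * eta * nuclear_norm (mom k.+1 - grad F (x k.+1)) + L / 2 * eta ^+ 2.
Proof.
have [d1 dmin] := muon_lmo run (ltn0Sn k).
rewrite (muon_x run (ltn0Sn k)) (le_trans (descent hF hL hLip _ _))//.
set G := grad F _; set M := mom k.+1 in dmin *; set D := d k.+1 in d1 dmin *.
have sq : L / 2 * spectral_norm (eta *: D) ^+ 2 <= L / 2 * eta ^+ 2.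
  rewrite ler_wpM2l// ?divr_ge0// lerXn2r ?nnegrE ?spectral_norm_ge0//.
  by rewrite (le_trans (spectral_normZ_le _ _))// ger0_norm// ler_piMr.
have [E E1 ME] := nuclear_norm_attained M.
have MD : frob_inner M D <= - nuclear_norm M.
  by rewrite -ME -frob_innerNr; apply: dmin; exact: spectral_normN_le.
have GD : frob_inner G D <= frob_inner M D + nuclear_norm (M - G).
  rewrite -{1}(subrK M G) frob_innerDl addrC lerD2l -(nuclear_normN (M - G)).
  by rewrite opprB frob_inner_le_nuclear.
have GM : nuclear_norm G <= nuclear_norm M + nuclear_norm (M - G).
  rewrite -(nuclear_normN (M - G)) opprB -{1}(subrK M G) addrC.
  exact: ler_nuclear_normD.
rewrite frob_innerZr; move: eta0 sq MD GD GM.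
move: (F _) (frob_inner G D) (frob_inner M D) (nuclear_norm G) (nuclear_norm M)
  (nuclear_norm (M - G)) (L / 2 * _) (L / 2 * _) => f gd md ng nm e q q'.
move=> e0 {}sq {}MD {}GD {}GM.
have : eta * gd <= eta * (- ng + 2 * e) by apply: ler_wpM2l => //; lra.
by lra.
Qed.

(** Telescoping the one-step decrease along the trajectory. *)
Lemma muon_path_bound (T : nat) (Delta : R) : 0 < eta ->
  (forall y, F x1 - F y <= Delta) ->
  \sum_(k < T) nuclear_norm (grad F (x k.+1)) <=
    Delta / eta + T%:R * (L * eta / 2 + 2 * (L * eta * beta / (1 - beta)))
    + \sum_(k < T) 2 * (beta ^+ k * nuclear_norm (eps 1)
                    + nuclear_norm (noise beta (fun k => eps k.+2) k)).
Proof.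
move=> eta1 hD; set S := \sum_(k < T) nuclear_norm _.
pose K := L * eta * beta / (1 - beta).
pose B k := beta ^+ k * nuclear_norm (eps 1)
            + nuclear_norm (noise beta (fun k => eps k.+2) k).
have tel t : F (x t.+1) <= F x1
    - eta * (\sum_(k < t) nuclear_norm (grad F (x k.+1)))
    + eta * (t%:R * (L * eta / 2 + 2 * K) + \sum_(k < t) 2 * B k).
  elim: t => [|t IH].
    by rewrite !big_ord0 (muon_x1 run) mul0r !addr0 mulr0 subr0 addr0.
  rewrite (le_trans (muon_step_decrease t))//.
  have := ler_wpM2l (ltW eta1) (momentum_error t).
  rewrite !big_ord_recr /= -/K -[t.+1%:R]natr1 -/(B t); move: IH.
  set s1 := \sum_(k < t) _; set s2 := \sum_(k < t) _.
  set G := nuclear_norm (grad _ _); set M := nuclear_norm (mom _ - _).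
  move: (F (x t.+1)) (F x1) (B t) s1 s2 G M K => f1 f0 b s1 s2 G M k.
  by move=> h1 h2; lra.
have := le_trans (tel T) (lexx _); have := hD (x T.+1); rewrite -/S => h1 h2.
rewrite -(ler_pM2l eta1) -/K [X in _ <= X](_ : _ = Delta +
  eta * (T%:R * (L * eta / 2 + 2 * K) + \sum_(k < T) 2 * B k)); last first.
  by rewrite /B; field; rewrite gt_eqF.
by lra.
Qed.

End MuonPath.

(** * Measurability of matrix-valued maps *)

Section MatrixMeasurability.
Variable R : realType.
Implicit Types m n : nat.

Lemma lipschitz_continuous_mx m n (f : 'M[R]_(m, n) -> R) (C : R) : 0 <= C ->
  (forall A B, f A - f B <= C * `|A - B|) -> continuous f.
Proof.
move=> C0 hf A; apply/(@cvgrPdist_lt _ _ _ (nbhs A) (nbhs_filter A)) => e e0.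
apply/nbhs_ballP; exists (e / (C + 1)) => /= [|B].
  by rewrite divr_gt0// ltr_wpDl.
rewrite -ball_normE /= ltr_pdivlMr ?ltr_wpDl// => AB.
rewrite (@le_lt_trans _ _ (C * `|A - B|))//.
  by rewrite ler_norml lerNl opprB [in X in X && _]distrC !hf.
by rewrite (le_lt_trans _ AB)// mulrC ler_wpM2l// lerDl.
Qed.

Lemma continuous_measurable_mx m n (f : 'M[R]_(m, n) -> R) :
  continuous f -> measurable_fun [set: 'M[R]_(m, n)] f.
Proof.
move=> /continuousP cf; apply: (measurability _ (RGenOpens.measurableE R)).
move=> _ [_ [a [b ->] <-]]; rewrite setTI; apply: sub_sigma_algebra.
exact/cf/interval_open.
Qed.

Lemma lipschitz_measurable_mx m n (f : 'M[R]_(m, n) -> R) (C : R) : 0 <= C ->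
  (forall A B, f A - f B <= C * `|A - B|) ->
  measurable_fun [set: 'M[R]_(m, n)] f.
Proof.
by move=> C0 /(lipschitz_continuous_mx C0); exact: continuous_measurable_mx.
Qed.

Let box m n (q : 'M[rat]_(m, n)) (k : nat) : set 'M[R]_(m, n) :=
  [set A | forall i j, `|A i j - ratr (q i j)| < k.+1%:R^-1].

(** Boxes with rational centre and radius form a countable base. *)
Let open_bigcup_box m n (U : set 'M[R]_(m, n)) : open U ->
  U = \bigcup_(z : 'M[rat]_(m, n) * nat)
        (if `[< box z.1 z.2 `<=` U >] then box z.1 z.2 else set0).
Proof.
move=> oU; apply/seteqP; split=> [A UA|A [[q k] _ /=]]; last first.
  by case: asboolP => // + qA; apply.
have /nbhs_ballP[e /= e0 eU] : nbhs A U by exact: open_nbhs_nbhs.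
have [k ke] : exists k, k.+1%:R^-1 < e / 2.
  have e2 : 0 < e / 2 by rewrite divr_gt0.
  exists (Num.truncn (e / 2)^-1); rewrite invf_plt ?posrE//.
  exact: truncnS_gt.
have rk (i : 'I_m) (j : 'I_n) : exists q : rat,
    `|A i j - ratr q| < k.+1%:R^-1.
  have /rat_in_itvoo[q] : A i j - k.+1%:R^-1 < A i j + k.+1%:R^-1.
    by rewrite ltrBlDr -addrA ltrDl addr_gt0.
  rewrite in_itv /= => /andP[q1 q2]; exists q; rewrite ltr_norml.
  move: q1 q2; move: (ratr q) (k.+1%:R^-1) => y r *.
  by apply/andP; split; lra.
pose q : 'M[rat]_(m, n) := \matrix_(i, j) sval (cid (rk i j)).
have qA : box q k A by move=> i j; rewrite mxE; case: cid.
exists (q, k) => //=; case: asboolP => // -[]; move=> B qB; apply: eU.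
split=> // i j; have := qA i j; have := qB i j.
move: ke; move: (ratr _) (k.+1%:R^-1) => y r re.
rewrite !ltr_norml => /andP[? ?] /andP[? ?].
by rewrite /ball /= ltr_norml; apply/andP; split; lra.
Qed.

Lemma measurable_entry m n i j :
  measurable_fun [set: 'M[R]_(m, n)] (fun A : 'M[R]_(m, n) => A i j).
Proof.
apply: (@lipschitz_measurable_mx _ _ _ 1) => // A B; rewrite mul1r.
have -> : A i j - B i j = (A - B) i j by rewrite !mxE.
rewrite (le_trans (ler_norm _))//; exact: normr_mx_entry.
Qed.

(** The Borel sets of the space of matrices are generated by the entries. *)
Lemma measurable_mxP d (T : measurableType d) m n (f : T -> 'M[R]_(m, n)) :
  (forall i j, measurable_fun [set: T] (fun w => f w i j)) ->
  measurable_fun [set: T] f.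
Proof.
move=> mf; apply: (@measurability _ _ _ _ _ _ (@open 'M[R]_(m, n))) => //.
move=> _ [U /open_bigcup_box -> <-]; rewrite setTI preimage_bigcup.
apply: countable_bigcupT_measurable => [|[q k] /=].
  exact: countableP.
case: asboolP => _; last by rewrite preimage_set0.
rewrite (_ : _ @^-1` _ = \bigcap_(ij in [set: 'I_m * 'I_n])
  ((fun w => f w ij.1 ij.2) @^-1` [set y | `|y - ratr (q ij.1 ij.2)| < k.+1%:R^-1])).
  apply: fin_bigcap_measurable; first exact: finite_finset.
  move=> [i j] _ /=; rewrite -[X in measurable X]setTI; apply: mf => //.
  rewrite (_ : mkset _ = `]ratr (q i j) - k.+1%:R^-1, ratr (q i j) + k.+1%:R^-1[%classic).
    exact: measurable_itv.
  move: (ratr _) (k.+1%:R^-1) => q' r.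
  apply/seteqP; split=> y /=; rewrite in_itv /= ltr_norml => /andP[? ?].
    by apply/andP; split; lra.
  by apply/andP; split; lra.
apply/seteqP; split => w /=; first by move=> h [i j] _; exact: h.
by move=> h i j; exact: (h (i, j)).
Qed.

Lemma measurable_fun_entry d (T : measurableType d) m n (f : T -> 'M[R]_(m, n))
  i j : measurable_fun [set: T] f -> measurable_fun [set: T] (fun w => f w i j).
Proof. by move=> mf; exact: measurableT_comp (measurable_entry i j) mf. Qed.

Lemma measurable_mxD d (T : measurableType d) m n (f g : T -> 'M[R]_(m, n)) :
  measurable_fun [set: T] f -> measurable_fun [set: T] g ->
  measurable_fun [set: T] (fun w => f w + g w).
Proof.
move=> mf mg; apply: measurable_mxP => i j.
under eq_fun do rewrite mxE.
by apply: measurable_funD; exact: measurable_fun_entry.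
Qed.

Lemma measurable_mxZ d (T : measurableType d) m n (c : R) (f : T -> 'M[R]_(m, n)) :
  measurable_fun [set: T] f -> measurable_fun [set: T] (fun w => c *: f w).
Proof.
move=> mf; apply: measurable_mxP => i j.
under eq_fun do rewrite mxE.
by apply: measurable_funM => //; exact: measurable_fun_entry.
Qed.

Lemma measurable_mxB d (T : measurableType d) m n (f g : T -> 'M[R]_(m, n)) :
  measurable_fun [set: T] f -> measurable_fun [set: T] g ->
  measurable_fun [set: T] (fun w => f w - g w).
Proof.
move=> mf mg; apply: measurable_mxP => i j.
under eq_fun do rewrite !mxE.
by apply: measurable_funB; exact: measurable_fun_entry.
Qed.

Lemma ler_nuclear_normB m n (A B : 'M[R]_(m, n)) :
  nuclear_norm A - nuclear_norm B <= nuclear_norm (A - B).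
Proof. by rewrite lerBlDr -{1}(subrK B A) ler_nuclear_normD. Qed.

Lemma measurable_nuclear_norm m n :
  measurable_fun [set: 'M[R]_(m, n)] (@nuclear_norm R m n).
Proof.
apply: lipschitz_measurable_mx => [|A B].
  by apply: mulr_ge0 (sqrtr_ge0 (minn m n)%:R) (sqrtr_ge0 (m * n)%:R).
exact: le_trans (ler_nuclear_normB _ _) (nuclear_le_normr _).
Qed.

Lemma measurable_smoothed m n (a : R) : 0 < a ->
  measurable_fun [set: 'M[R]_(m, n)] (@smoothed_nuclear_norm R m n a).
Proof.
move=> a0; apply: lipschitz_measurable_mx => [|A B].
  by apply: mulr_ge0 (sqrtr_ge0 (minn m n)%:R) (sqrtr_ge0 (m * n)%:R).
exact: le_trans (smoothed_lipschitz a0 _ _) (nuclear_le_normr _).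
Qed.

Lemma measurable_grad m n (F : 'M[R]_(m, n) -> R) (L : R) : 0 <= L ->
  (forall y z, nuclear_norm (grad F y - grad F z) <= L * spectral_norm (y - z)) ->
  measurable_fun [set: 'M[R]_(m, n)] (grad F).
Proof.
move=> L0 hLip; apply: measurable_mxP => i j.
apply: (@lipschitz_measurable_mx _ _ _ (L * Num.sqrt (m * n)%:R)) => [|A B].
  by rewrite mulr_ge0// sqrtr_ge0.
have -> : grad F A i j - grad F B i j = (grad F A - grad F B) i j.
  by rewrite !mxE.
rewrite (le_trans (ler_norm _))// (le_trans (normr_entry_le_nuclear _ _ _))//.
rewrite (le_trans (hLip _ _))// -mulrA ler_wpM2l//.
exact: le_trans (spectral_le_frob _) (sqrt_frob_le_normr _).
Qed.

End MatrixMeasurability.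

(** * Independence of the past and a fresh sample *)

Section IndependentEvents.
Context (R : realType) (dO : measure_display) (Omega : measurableType dO).
Variable P : probability Omega R.
Implicit Types X S : set Omega.
Local Open Scope ereal_scope.

Lemma indep_setC X S : measurable X -> measurable S ->
  P (S `&` X) = P S * P X -> P (~` S `&` X) = P (~` S) * P X.
Proof.
move=> mX mS SX; rewrite setIC -setDE measureD//; last first.
  by rewrite -ge0_fin_numE// fin_num_measure.
rewrite [X in _ - X](_ : _ = P S * P X); last first.
  by rewrite -SX; congr (P _); exact: setIC.
rewrite probability_setC// muleBl//; first by rewrite mul1e.
by rewrite fin_num_measure.
Qed.

Lemma indep_bigcup X (S : nat -> set Omega) : measurable X ->
  trivIset [set: nat] S ->
  (forall k, measurable (S k) /\ P (S k `&` X) = P (S k) * P X) ->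
  P (\bigcup_k S k `&` X) = P (\bigcup_k S k) * P X.
Proof.
move=> mX tS SX; rewrite setI_bigcupl measure_bigcup//; last 2 first.
- by move=> k _; apply: measurableI => //; have [] := SX k.
- exact: trivIset_setIr.
rewrite measure_bigcup//; last by move=> k _; have [] := SX k.
rewrite [RHS]muleC -[P X]fineK ?fin_num_measure// -nneseriesZl//.
apply: eq_eseriesr => k _; rewrite fineK ?fin_num_measure// muleC.
exact: (SX k).2.
Qed.

End IndependentEvents.

Section Independence.
Context (R : realType) (dO dX : measure_display).
Context (Omega : measurableType dO) (Xi : measurableType dX).
Variables (P : probability Omega R) (xi : nat -> {RV P >-> Xi}).
Hypothesis indep : mutually_independent [set t | (1 <= t)%N] xi.
Local Open Scope ereal_scope.

Let past t : {fset nat} := [fset s | s in iota 1 t]%fset.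

Let in_past t s : (s \in past t) = (1 <= s <= t)%N.
Proof. by rewrite in_fset /= mem_iota add1n ltnS. Qed.

Let cylinder t : set (set Omega) :=
  [set E | exists2 B : nat -> set Xi, (forall s, measurable (B s)) &
           E = \bigcap_(s in [set` past t]) (xi s @^-1` B s)].

Let cylinder_measurable t E : cylinder t E -> measurable E.
Proof.
move=> [B mB ->]; apply: fin_bigcap_measurable => // s _.
by rewrite -[X in measurable X]setTI; exact: measurable_funP.
Qed.

Let cylinder_setI t : setI_closed (cylinder t).
Proof.
move=> _ _ [B mB ->] [C mC ->]; exists (fun s => B s `&` C s).
  by move=> s; exact: measurableI.
rewrite -bigcapI; apply: eq_bigcapr => s _.
by rewrite preimage_setI.
Qed.

Let history_cylinder t :
  history (fun s => xi s : Omega -> Xi) t `<=` <<s cylinder t>>.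
Proof.
apply: sub_sigma_algebra2 => _ [s /= st [C mC <-]].
exists (fun u => if u == s then C else setT) => [u|].
  by case: ifP.
rewrite setTI; apply/seteqP; split=> w /=.
  by move=> wC u _ /=; case: eqP => [->|].
by move=> /(_ s); rewrite /= in_past st eqxx; apply.
Qed.

Let cylinder_indep t E C : cylinder t E -> measurable C ->
  P (E `&` xi t.+1 @^-1` C) = P E * P (xi t.+1 @^-1` C).
Proof.
move=> [B mB ->] mC; pose B' s := if s == t.+1 then C else B s.
have mB' s : measurable (B' s) by rewrite /B'; case: ifP.
have tN : t.+1 \notin past t by rewrite in_past ltnn andbF.
have B'E s : s \in past t -> B' s = B s.
  by rewrite /B'; case: eqP => // ->; rewrite (negbTE tN).
have -> : \bigcap_(s in [set` past t]) (xi s @^-1` B s) `&` xi t.+1 @^-1` C =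
    \bigcap_(s in [set` (t.+1 |` past t)%fset]) (xi s @^-1` B' s).
  apply/seteqP; split=> w /= => [[h hC] s|h].
    rewrite /= in_fset1U => /orP[/eqP ->|sp]; first by rewrite /= /B' eqxx.
    by rewrite /preimage /= B'E//; exact: h.
  split=> [s sp|].
    by have := h s; rewrite /= in_fset1U sp orbT /preimage /= B'E//; apply.
  by have := h t.+1; rewrite /= in_fset1U eqxx /preimage /= /B' eqxx; apply.
rewrite indep//; last first.
  by move=> s /=; rewrite in_fset1U => /orP[/eqP -> //|]; rewrite in_past => /andP[].
rewrite indep//; last by move=> s /=; rewrite in_past => /andP[].
rewrite big_fsetU1//= {1}/B' eqxx muleC; congr (_ * _).
by apply: eq_big_seq => s /B'E ->.
Qed.

(** The identity holds for cylinder sets by hypothesis, and these form a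
    pi-system generating the history. *)
Lemma history_indep t E C : history (fun s => xi s : Omega -> Xi) t E ->
  measurable C -> P (E `&` xi t.+1 @^-1` C) = P E * P (xi t.+1 @^-1` C).
Proof.
move=> /history_cylinder hE mC; set X := xi t.+1 @^-1` C.
have mX : measurable X.
  by rewrite -[X in measurable X]setTI; exact: measurable_funP.
suff : measurable E /\ P (E `&` X) = P E * P X by case.
move: E hE; apply: (@dynkin_induction _ (g_sigma_algebraType (cylinder t)) (cylinder t)) => //.
- by split; [exact: measurableT|rewrite setTI probability_setT mul1e].
- by move=> E cE; split; [exact: cylinder_measurable cE|exact: cylinder_indep].
- by move=> S _ [mS SX]; split; [exact: measurableC|exact: indep_setC].
- move=> S _ tS SX; split; last exact: indep_bigcup.
  by apply: bigcup_measurable => k _; have [] := SX k.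
Qed.

End Independence.

(** Integrating out a fresh sample: if [X] is independent of [Y] then the pair
    is distributed as the product of its marginals, and Tonelli applies. *)
Lemma integral_fresh (R : realType) (dO dX dY : measure_display)
    (Omega : measurableType dO) (Xi : measurableType dX)
    (Psi : measurableType dY) (P : probability Omega R)
    (Y : Omega -> Psi) (X X0 : {RV P >-> Xi}) (f : Psi * Xi -> \bar R) :
  measurable_fun [set: Omega] Y ->
  (forall A B, measurable A -> measurable B ->
     P (Y @^-1` A `&` X @^-1` B) = P (Y @^-1` A) * P (X @^-1` B))%E ->
  (forall B, measurable B -> distribution P X B = distribution P X0 B) ->
  measurable_fun [set: Psi * Xi] f -> (forall z, 0 <= f z)%E ->
  (\int[P]_w f (Y w, X w) = \int[P]_w \int[P]_v f (Y w, X0 v))%E.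
Proof.
move=> mY YX XX0 mf f0.
pose Ym := @isMeasurableFun.Build _ _ _ _ Y mY.
pose Yf : {RV P >-> Psi} := HB.pack Y Ym.
have mYX : measurable_fun [set: Omega] (fun w => (Yf w, X w)).
  by apply: measurable_fun_pair => //; exact: measurable_funP.
pose YXm := @isMeasurableFun.Build _ _ _ _ _ mYX.
pose YXf : {RV P >-> (Psi * Xi)%type} := HB.pack (fun w => (Yf w, X w)) YXm.
transitivity (\int[distribution P YXf]_z f z)%E.
  by rewrite ge0_integral_distribution.
transitivity (\int[distribution P Yf \x distribution P X0]_z f z)%E.
  apply: eq_measure_integral => /= A mA _; apply/esym.
  apply: product_measure_unique => // B C mB mC.
  by apply: (eq_trans (YX B C mB mC)); congr (_ * _)%E; exact: XX0.
rewrite fubini_tonelli1// ge0_integral_distribution//; last 2 first.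
- exact: measurable_fun_fubini_tonelli_F.
- by move=> y; apply: integral_ge0.
apply: eq_integral => w _ /=; rewrite /fubini_F ge0_integral_distribution//.
exact: measurableT_comp.
Qed.

(** * Moment inequalities for one random matrix *)

Lemma integral_probability_cst (R : realType) d (T : measurableType d)
  (P : probability T R) (c : R) : (\int[P]_w c%:E = c%:E)%E.
Proof.
transitivity (c%:E * P setT)%E; first exact: integral_cst.
by rewrite probability_setT mule1.
Qed.

Section MomentInequality.
Context (R : realType) (dO : measure_display) (Omega : measurableType dO).
Variables (P : probability Omega R) (m n : nat).
Variable Z : Omega -> 'M[R]_(m, n).
Hypothesis mZ : measurable_fun [set: Omega] Z.
Variables (p S : R).
Hypotheses (p1 : 1 < p) (p2 : p <= 2).
Hypothesis hS : (\int[P]_w (nuclear_norm (Z w) `^ p)%:E <= S%:E)%E.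

Let mnZ : measurable_fun [set: Omega] (fun w => nuclear_norm (Z w)).
Proof. exact: (measurableT_comp (@measurable_nuclear_norm R m n) mZ). Qed.

Let mpZ : measurable_fun [set: Omega] (fun w => nuclear_norm (Z w) `^ p).
Proof. exact: (measurableT_comp (measurable_powR p) mnZ). Qed.

Let mkZ (k : R) :
  measurable_fun [set: Omega] (fun w => k%:E * (nuclear_norm (Z w) `^ p)%:E)%E.
Proof. by apply: measurable_funeM; exact/measurable_EFinP. Qed.

Lemma integrable_moment :
  P.-integrable setT (fun w => (nuclear_norm (Z w) `^ p)%:E).
Proof.
apply/integrableP; split; first exact/measurable_EFinP.
under eq_integral do rewrite gee0_abs ?lee_fin ?powR_ge0//.
exact: le_lt_trans hS (ltry _).
Qed.

Lemma integrable_nuclear : P.-integrable setT (fun w => (nuclear_norm (Z w))%:E).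
Proof.
apply: (@le_integrable _ _ _ _ _ _ _
  (fun w => (cst 1 w)%:E + (nuclear_norm (Z w) `^ p)%:E)%E) => //.
- exact/measurable_EFinP.
- move=> w _; rewrite -EFinD /= lee_fin ger0_norm ?nuclear_norm_ge0//.
  rewrite ger0_norm ?addr_ge0 ?powR_ge0//.
  have [z1|z1] := leP 1 (nuclear_norm (Z w)).
    by rewrite (le_trans (le1r_powR z1 (ltW p1)))// lerDr.
  by rewrite (le_trans (ltW z1))// lerDl powR_ge0.
- apply: integrableD => //; first exact: finite_measure_integrable_cst.
  exact: integrable_moment.
Qed.

Lemma integrable_entry i j : P.-integrable setT (fun w => (Z w i j)%:E).
Proof.
apply: (le_integrable _ _ _ integrable_nuclear) => //.
  by apply/measurable_EFinP; exact: measurable_fun_entry.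
move=> w _; rewrite /= lee_fin (ger0_norm (nuclear_norm_ge0 _)).
exact: normr_entry_le_nuclear.
Qed.

(** Integrate the inequality of Young,
    [z * s ^ (p - 1) <= z ^ p / p + s ^ p / q] for conjugate [p] and [q]. *)
Lemma moment_le (s : R) : 0 < s -> S <= s `^ p ->
  (\int[P]_w (nuclear_norm (Z w))%:E <= s%:E)%E.
Proof.
move=> s0 Ss; pose c := s `^ (p - 1); pose q := p / (p - 1).
have p0 : 0 < p by exact: lt_trans ltr01 p1.
have pB0 : 0 < p - 1 by rewrite subr_gt0.
have c0 : 0 < c by exact: powR_gt0.
have q0 : 0 < q by rewrite divr_gt0.
have cq : c `^ q = s `^ p.
  by rewrite /c -powRrM /q mulrCA divff ?mulr1// gt_eqF.
have pq : p^-1 + q^-1 = 1 by rewrite /q; field; rewrite !gt_eqF.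
have ub w : ((nuclear_norm (Z w))%:E <=
    (c^-1 / p)%:E * (nuclear_norm (Z w) `^ p)%:E + (c^-1 * (s `^ p / q))%:E)%E.
  rewrite -EFinM -EFinD lee_fin /=.
  have := conjugate_powR (nuclear_norm_ge0 (Z w)) (ltW c0) p0 q0 pq.
  rewrite cq -ler_pdivlMr// => /le_trans; apply.
  by rewrite le_eqVlt; apply/orP; left; apply/eqP; field; rewrite !gt_eqF.
have ic0 : 0 <= c^-1 / p by rewrite divr_ge0 ?invr_ge0 ?ltW.
have c'0 : 0 <= c^-1 * (s `^ p / q).
  by rewrite mulr_ge0 ?divr_ge0 ?invr_ge0 ?powR_ge0 ?ltW.
apply: le_trans (ge0_le_integral _ _ _ _ _ (fun w _ => ub w)) _ => //.
- by move=> w _; rewrite lee_fin nuclear_norm_ge0.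
- exact/measurable_EFinP.
- by apply: emeasurable_funD; [exact: mkZ|exact: measurable_cst].
rewrite ge0_integralD//; last first.
  by move=> w _; rewrite mule_ge0 ?lee_fin ?powR_ge0.
rewrite ge0_integralZl//; last 2 first.
- exact/measurable_EFinP.
- by move=> w _; rewrite lee_fin powR_ge0.
rewrite integral_probability_cst.
have h1 : ((c^-1 / p)%:E * \int[P]_w (nuclear_norm (Z w) `^ p)%:E <=
    (c^-1 / p * s `^ p)%:E)%E.
  by rewrite [leRHS]EFinM lee_wpmul2l ?lee_fin// (le_trans hS)// lee_fin.
apply: le_trans (leeD2r _ h1) _; rewrite -EFinD lee_fin.
rewrite -mulrA -mulrDr mulrC -ler_pdivlMr ?invr_gt0// invrK.
by rewrite (mulrC _ (s `^ p)) -mulrDr pq mulr1 /c (mulr_powRB1 (ltW s0) p0).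
Qed.

Lemma integral_frob_centered D : (forall i j, \int[P]_w (Z w i j)%:E = 0)%E ->
  P.-integrable setT (fun w => (frob_inner (Z w) D)%:E) /\
  (\int[P]_w (frob_inner (Z w) D)%:E = 0)%E.
Proof.
move=> Z0; have iZ i j : P.-integrable setT (fun w => ((D i j)%:E * (Z w i j)%:E)%E).
  by apply: integrableZl => //; exact: integrable_entry.
have E : (fun w => (frob_inner (Z w) D)%:E) =
    (fun w => \sum_(i < m) \sum_(j < n) ((D i j)%:E * (Z w i j)%:E))%E.
  apply/funext => w; rewrite /frob_inner -sumEFin; apply: eq_bigr => i _.
  by rewrite -sumEFin; apply: eq_bigr => j _; rewrite mulrC EFinM.
rewrite E; split.
  by apply: integrable_sum => // i _; apply: integrable_sum => // j _; exact: iZ.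
rewrite integral_sum// => [|i]; last by apply: integrable_sum.
rewrite big1// => i _; rewrite integral_sum// big1// => j _.
by rewrite integralZl// ?Z0 ?mule0//; exact: integrable_entry.
Qed.

(** [smoothed_increment] is integrated for each fixed [D]; the supremum over [D]
    is taken afterwards. *)
Lemma smoothed_add_centered (a : R) A : 0 < a ->
  (forall i j, \int[P]_w (Z w i j)%:E = 0)%E ->
  (\int[P]_w (smoothed_nuclear_norm a (A + Z w))%:E <=
   (smoothed_nuclear_norm a A + 2 * a `^ (p - 1) * S)%:E)%E.
Proof.
move=> a0 Z0; set h := smoothed_nuclear_norm a.
have mh : measurable_fun [set: Omega] (fun w => h (A + Z w)).
  apply: (measurableT_comp (@measurable_smoothed R m n a a0)).
  by apply: measurable_mxD.
pose c D := 2 * h A - (frob_inner A D - frob_inner D D / (4 * a)).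
have k0 : 0 <= 2 * a `^ (p - 1) by rewrite mulr_ge0 ?powR_ge0.
(* [c D] collects the terms of [smoothed_increment] that are free of [Z]. *)
have ub D : spectral_norm D <= 1 ->
    (\int[P]_w (h (A + Z w))%:E <= (c D + 2 * a `^ (p - 1) * S)%:E)%E.
  move=> D1; have [iD ZD] := integral_frob_centered D Z0.
  have ub w : ((h (A + Z w))%:E <= (c D)%:E
      + ((2 * a `^ (p - 1))%:E * (nuclear_norm (Z w) `^ p)%:E
         + (frob_inner (Z w) D)%:E))%E.
    rewrite -EFinM -!EFinD lee_fin /=.
    by have := smoothed_increment a0 A (Z w) p1 p2 D1; rewrite /c -/h; lra.
  have ik : P.-integrable setT
      (fun w => ((2 * a `^ (p - 1))%:E * (nuclear_norm (Z w) `^ p)%:E)%E).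
    by apply: integrableZl => //; exact: integrable_moment.
  have ic := @finite_measure_integrable_cst _ _ R P setT (c D) measurableT.
  apply: le_trans (ge0_le_integral _ _ _ _ _ (fun w _ => ub w)) _ => //.
  - by move=> w _; rewrite lee_fin smoothed_ge0.
  - exact/measurable_EFinP.
  - apply: emeasurable_funD => //.
    by apply: emeasurable_funD; exact: measurable_int (_ : P.-integrable _ _).
  rewrite integralD//; last exact: integrableD.
  rewrite integralD// ZD adde0 integralZl//; last exact: integrable_moment.
  rewrite integral_probability_cst [leRHS]EFinD leeD2l//.
  by rewrite [leRHS]EFinM lee_wpmul2l// lee_fin.
have I0 : (0 <= \int[P]_w (h (A + Z w))%:E)%E.
  by apply: integral_ge0 => w _; rewrite lee_fin smoothed_ge0.
have fI : (\int[P]_w (h (A + Z w))%:E)%E \is a fin_num.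
  rewrite ge0_fin_numE// (le_lt_trans (ub 0 _)) ?ltry//.
  by rewrite spectral_norm0.
move: ub I0; rewrite -(fineK fI); set I := fine _ => ub _.
rewrite lee_fin; suff : h A <= 2 * h A + 2 * a `^ (p - 1) * S - I by lra.
by apply: smoothed_le => D /ub; rewrite lee_fin /c; lra.
Qed.

End MomentInequality.

(** * Accumulation of the noise along the algorithm *)

Section AdaptedProcesses.
Context (dO dX : measure_display) (Omega : measurableType dO).
Context (Xi : measurableType dX) (xi : nat -> Omega -> Xi).
Hypothesis mxi : forall t, measurable_fun [set: Omega] (xi t).

(** The sample space with the sigma-algebra of the first [t] samples, so that
    being determined by the past is measurability on this type. *)
Definition past_space (t : nat) : Type := g_sigma_algebraType
  (\bigcup_(s in [set s | (1 <= s <= t)%N]) g_sigma_algebra_preimage (xi s)).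
HB.instance Definition _ t := Measurable.on (past_space t).

Lemma past_space_mono s t d (T : measurableType d) (f : Omega -> T) :
  (s <= t)%N -> measurable_fun [set: past_space s] f ->
  measurable_fun [set: past_space t] f.
Proof.
move=> st mf _ B mB; have := mf measurableT B mB.
apply: sub_sigma_algebra2 => E [u /= /andP[u1 us] uE].
by exists u => //=; rewrite u1 (leq_trans us).
Qed.

Lemma measurable_past_sample s t : (1 <= s <= t)%N ->
  measurable_fun [set: past_space t] (xi s).
Proof. by move=> st _ B mB; apply: sub_sigma_algebra; exists s => //; exists B. Qed.

Lemma measurable_past_space t d (T : measurableType d) (f : Omega -> T) :
  measurable_fun [set: past_space t] f -> measurable_fun [set: Omega] f.
Proof.
move=> mf _ B mB; have := mf measurableT B mB.
apply: smallest_sub; first exact: sigma_algebra_measurable.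
by move=> E [s _ [C mC <-]]; exact: mxi.
Qed.

End AdaptedProcesses.

Section NoiseAccumulation.
Context (R : realType) (m n : nat) (dO dX : measure_display).
Context (Omega : measurableType dO) (Xi : measurableType dX).
Variables (P : probability Omega R) (p : R).
Hypotheses (p1 : 1 < p) (p2 : p <= 2).
Variables (F : 'M[R]_(m, n) -> R) (g : 'M[R]_(m, n) -> Xi -> 'M[R]_(m, n)).
Variables (L sigma : R) (L0 : 0 <= L) (sigma0 : 0 < sigma).
Hypothesis hLip : forall y z,
  nuclear_norm (grad F y - grad F z) <= L * spectral_norm (y - z).
Hypothesis hg : measurable_fun [set: 'M[R]_(m, n) * Xi] (fun z => g z.1 z.2).
Variable xi0 : {RV P >-> Xi}.
Hypothesis hmean : forall y i j,
  ('E_P[fun w => g y (xi0 w) i j] = (grad F y i j)%:E)%E.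
Hypothesis hnoise : forall y,
  ('E_P[fun w => (nuclear_norm (g y (xi0 w) - grad F y) `^ p)%R]
   <= (sigma `^ p)%R%:E)%E.
Variable xi : nat -> {RV P >-> Xi}.
Hypothesis hxi_law : forall t, (1 <= t)%N ->
  forall B, measurable B -> distribution P (xi t) B = distribution P xi0 B.
Hypothesis hxi_indep : mutually_independent [set t | (1 <= t)%N] xi.
Variables (x1 : 'M[R]_(m, n)) (eta beta : R).
Hypothesis beta01 : 0 <= beta <= 1.
Variables x d : nat -> Omega -> 'M[R]_(m, n).
Hypothesis hx1 : forall w, x 1 w = x1.
Hypothesis hx : forall t, (1 <= t)%N -> forall w, x t.+1 w = x t w + eta *: d t w.
Hypothesis hd : forall t, (1 <= t)%N -> forall B, measurable B ->
  history (fun t => xi t : Omega -> Xi) t (d t @^-1` B).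

Local Notation past := (past_space (fun t => xi t : Omega -> Xi)).

Let mxi t : measurable_fun [set: Omega] (xi t).
Proof. exact: measurable_funP. Qed.

Lemma measurable_iterate k : measurable_fun [set: past k] (x k.+1).
Proof.
elim: k => [|k IH].
  by rewrite (_ : x 1 = cst x1); [exact: measurable_cst|apply/funext].
rewrite (_ : x k.+2 = fun w => x k.+1 w + eta *: d k.+1 w); last first.
  by apply/funext => w; exact: hx.
apply: measurable_mxD; first exact: past_space_mono (leqnSn k) IH.
by apply: measurable_mxZ => _ B mB; rewrite setTI; exact: hd.
Qed.

Definition sample_noise t w := g (x t w) (xi t w) - grad F (x t w).

Let mgrad : measurable_fun [set: 'M[R]_(m, n)] (grad F).
Proof. exact: measurable_grad L0 hLip. Qed.

Let measurable_oracle d' (T : measurableType d') (y : T -> 'M[R]_(m, n))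
    (v : T -> Xi) :
  measurable_fun [set: T] y -> measurable_fun [set: T] v ->
  measurable_fun [set: T] (fun w => g (y w) (v w)).
Proof.
by move=> my mv; exact: (measurableT_comp hg (measurable_fun_pair my mv)).
Qed.

Lemma measurable_sample_noise k :
  measurable_fun [set: past k.+1] (sample_noise k.+1).
Proof.
have mx : measurable_fun [set: past k.+1] (x k.+1).
  exact: past_space_mono (leqnSn k) (@measurable_iterate k).
apply: measurable_mxB; last exact: measurableT_comp mgrad mx.
apply: measurable_oracle => //.
by apply: measurable_past_sample; rewrite leqnn.
Qed.

Definition acc_noise k w := noise beta (fun k => sample_noise k.+2 w) k.

Lemma measurable_acc_noise k : measurable_fun [set: past k.+1] (acc_noise k).
Proof.
elim: k => [|k IH]; first exact: measurable_cst.
apply: measurable_mxD; apply: measurable_mxZ.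
  exact: past_space_mono (leqnSn _) IH.
exact: measurable_sample_noise.
Qed.

Let Z y v := g y (xi0 v) - grad F y.

Let mZ y : measurable_fun [set: Omega] (Z y).
Proof.
apply: measurable_mxB; last exact: measurable_cst.
apply: measurable_oracle; first exact: measurable_cst.
exact: measurable_funP.
Qed.

Let moment y :
  (\int[P]_v (nuclear_norm (Z y v) `^ p)%:E <= (sigma `^ p)%:E)%E.
Proof. by have := hnoise y; rewrite unlock. Qed.

Let mean0 y i j : (\int[P]_v (Z y v i j)%:E = 0)%E.
Proof.
have iZ := integrable_entry (mZ y) p1 (moment y) i j.
have ig : P.-integrable setT (fun v => (g y (xi0 v) i j)%:E).
  rewrite (_ : (fun v => _) = (fun v => (Z y v i j)%:E + (grad F y i j)%:E)%E).
    by apply: integrableD => //; exact: finite_measure_integrable_cst.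
  by apply/funext => v; rewrite -EFinD /Z !mxE subrK.
rewrite (_ : (fun v => (Z y v i j)%:E) =
    (fun v => (g y (xi0 v) i j)%:E - (grad F y i j)%:E)%E); last first.
  by apply/funext => v; rewrite -EFinB /Z !mxE.
rewrite integralB//; last exact: finite_measure_integrable_cst.
rewrite integral_probability_cst; have := hmean y i j; rewrite unlock => ->.
by rewrite subee.
Qed.

(** The initial noise enters in the nuclear norm itself, hence without a
    dimension factor. *)
Lemma initial_noise_le :
  (\int[P]_w (nuclear_norm (sample_noise 1 w))%:E <= sigma%:E)%E.
Proof.
have E : (\int[P]_w (nuclear_norm (sample_noise 1 w))%:E =
          \int[P]_w (nuclear_norm (Z x1 w))%:E)%E.
  pose f v := (nuclear_norm (g x1 v - grad F x1))%:E.
  have mf : measurable_fun [set: Xi] f.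
    apply/measurable_EFinP; apply: (measurableT_comp (@measurable_nuclear_norm R m n)).
    apply: measurable_mxB; last exact: measurable_cst.
    by apply: measurable_oracle; [exact: measurable_cst|exact: measurable_id].
  have f0 v : (0 <= f v)%E by rewrite lee_fin nuclear_norm_ge0.
  transitivity (\int[distribution P (xi 1%N)]_v f v)%E.
    rewrite (ge0_integral_distribution (xi 1%N) mf f0).
    by apply: eq_integral => w _; rewrite /= /f /sample_noise hx1.
  transitivity (\int[distribution P xi0]_v f v)%E.
    by apply: eq_measure_integral => B mB _; exact: hxi_law.
  exact: (ge0_integral_distribution xi0 mf f0).
rewrite E; exact: (moment_le (mZ x1) p1 (moment x1)).
Qed.

Section Smoothing.
Variable a : R.
Hypothesis a0 : 0 < a.
Local Notation h := (smoothed_nuclear_norm a).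

Let b0 : 0 <= beta. Proof. by case/andP: beta01. Qed.
Let b1 : 0 <= 1 - beta. Proof. by rewrite subr_ge0; case/andP: beta01. Qed.

Let fixed_step A y :
  (\int[P]_v (h (beta *: A + (1 - beta) *: Z y v))%:E <=
   (beta * h A + 2 * a `^ (p - 1) * ((1 - beta) `^ p * sigma `^ p))%:E)%E.
Proof.
have mcZ : measurable_fun [set: Omega] (fun v => (1 - beta) *: Z y v).
  exact: measurable_mxZ.
have mom : (\int[P]_v (nuclear_norm ((1 - beta) *: Z y v) `^ p)%:E <=
    ((1 - beta) `^ p * sigma `^ p)%:E)%E.
  have mn (Y : Omega -> 'M[R]_(m, n)) : measurable_fun [set: Omega] Y ->
      measurable_fun [set: Omega] (fun v => (nuclear_norm (Y v) `^ p)%:E).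
    move=> mY; apply/measurable_EFinP.
    apply: (measurableT_comp (measurable_powR p)).
    exact: (measurableT_comp (@measurable_nuclear_norm R m n) mY).
  rewrite [leRHS]EFinM.
  apply: le_trans (lee_wpmul2l _ (moment y)); last by rewrite lee_fin powR_ge0.
  rewrite -ge0_integralZl//; last 3 first.
  - exact: mn.
  - by move=> v _; rewrite lee_fin powR_ge0.
  - by rewrite lee_fin powR_ge0.
  apply: ge0_le_integral => //.
  - by move=> v _; rewrite lee_fin powR_ge0.
  - exact: mn.
  - by apply: measurable_funeM; exact: mn.
  move=> v _; rewrite -EFinM lee_fin -powRM ?nuclear_norm_ge0//.
  rewrite ge0_ler_powR ?nnegrE ?mulr_ge0 ?nuclear_norm_ge0//.
    by rewrite (le_trans ler01)// ltW.
  by rewrite (le_trans (nuclear_normZ_le _ _))// ger0_norm.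
have c0 i j : (\int[P]_v (((1 - beta) *: Z y v) i j)%:E = 0)%E.
  under eq_integral do rewrite mxE EFinM.
  rewrite integralZl ?mean0 ?mule0//.
  exact: (integrable_entry (mZ y) p1 (moment y)).
apply: le_trans (smoothed_add_centered mcZ p1 p2 mom _ a0 c0) _.
by rewrite lee_fin lerD2r; apply: smoothedZ_le => //; exact: beta01.
Qed.

(** The sample at time [k.+2] is independent of the iterate and of the noise
    accumulated before it, so that the increment is centred given the past. *)
Lemma acc_noise_smoothed k : (\int[P]_w (h (acc_noise k w))%:E <=
  (2 * a `^ (p - 1) * ((1 - beta) `^ (p - 1) * sigma `^ p))%:E)%E.
Proof.
set M := 2 * a `^ (p - 1) * _; pose c := (1 - beta) * M.
have M0 : 0 <= M by rewrite !mulr_ge0 ?powR_ge0.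
have mh : measurable_fun [set: 'M[R]_(m, n)] h by exact: measurable_smoothed.
elim: k => [|k IH].
  rewrite (_ : (fun w => _) = (fun=> 0%:E)).
    by rewrite integral_probability_cst lee_fin.
  apply/funext => w; congr (_%:E); apply/eqP; rewrite eq_le smoothed_ge0// andbT.
  by rewrite (le_trans (smoothed_le_nuclear a0 _))// nuclear_norm0.
pose Y w := (x k.+2 w, acc_noise k w).
pose f (z : ('M[R]_(m, n) * 'M[R]_(m, n)) * Xi) :=
  (h (beta *: z.1.2 + (1 - beta) *: (g z.1.1 z.2 - grad F z.1.1)))%:E.
have mY : measurable_fun [set: past k.+1] Y.
  apply: measurable_fun_pair; first exact: measurable_iterate.
  exact: measurable_acc_noise.
have mf : measurable_fun setT f.
  apply/measurable_EFinP; apply: (measurableT_comp mh).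
  have m11 : measurable_fun setT
      (fun z : ('M[R]_(m, n) * 'M[R]_(m, n)) * Xi => z.1.1).
    exact: (measurableT_comp measurable_fst measurable_fst).
  apply: measurable_mxD; apply: measurable_mxZ.
    exact: (measurableT_comp measurable_snd measurable_fst).
  apply: measurable_mxB; last exact: (measurableT_comp mgrad m11).
  exact: measurable_oracle m11 measurable_snd.
have -> : (\int[P]_w (h (acc_noise k.+1 w))%:E =
    \int[P]_w \int[P]_v f (Y w, xi0 v))%E.
  rewrite -(@integral_fresh _ _ _ _ _ _ _ P Y (xi k.+2))//.
  - exact: (measurable_past_space mxi mY).
  - move=> A B mA mB; apply: history_indep => //.
    by have := mY measurableT A mA; rewrite setTI.
  - by move=> B mB; exact: hxi_law.
  - by move=> z; rewrite lee_fin smoothed_ge0.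
have mhN : measurable_fun [set: Omega] (fun w => (h (acc_noise k w))%:E).
  apply/measurable_EFinP; apply: (measurableT_comp mh).
  exact: (measurable_past_space mxi (@measurable_acc_noise k)).
(* [c] is what makes [M] a fixed point of the recursion. *)
have step w : (\int[P]_v f (Y w, xi0 v) <=
    beta%:E * (h (acc_noise k w))%:E + c%:E)%E.
  apply: le_trans (fixed_step (acc_noise k w) (x k.+2 w)) _.
  rewrite -EFinM -EFinD lee_fin lerD2l /c /M.
  rewrite -(mulr_powRB1 b1 (lt_trans ltr01 p1)) le_eqVlt; apply/orP; left.
  by apply/eqP; ring.
have c0 : 0 <= c by rewrite mulr_ge0.
apply: le_trans (ge0_le_integral _ _ _ _ _ (fun w _ => step w)) _ => //.
- by move=> w _; apply: integral_ge0 => v _; rewrite lee_fin smoothed_ge0.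
- have f0 z : (0 <= f z)%E by rewrite lee_fin smoothed_ge0.
  have mF : measurable_fun setT (fubini_F (distribution P xi0) f).
    exact: measurable_fun_fubini_tonelli_F.
  apply: (eq_measurable_fun ((fubini_F (distribution P xi0) f) \o Y)).
    move=> w _ /=; rewrite /fubini_F.
    apply: (ge0_integral_distribution xi0 _ (fun v => f0 (Y w, v))).
    exact: (measurableT_comp mf (pair1_measurable (Y w))).
  exact: (measurableT_comp mF (measurable_past_space mxi mY)).
- apply: emeasurable_funD; last exact: measurable_cst.
  exact: measurable_funeM.
rewrite ge0_integralD//; last 2 first.
- by move=> w _; rewrite mule_ge0 ?lee_fin ?smoothed_ge0.
- exact: measurable_funeM.
rewrite ge0_integralZl//; last first.
  by move=> w _; rewrite lee_fin smoothed_ge0.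
rewrite integral_probability_cst.
have h1 : (beta%:E * \int[P]_w (h (acc_noise k w))%:E <= (beta * M)%:E)%E.
  by rewrite [leRHS]EFinM lee_wpmul2l// lee_fin.
apply: le_trans (leeD2r _ h1) _; rewrite -EFinD lee_fin /c.
by rewrite -mulrDl subrKC mul1r.
Qed.

End Smoothing.

(** The smoothing parameter balances the bias [minn m n / (4 * a)] against the
    growth of the smoothed norm. *)
Lemma acc_noise_le k : beta < 1 -> (1 <= m)%N -> (1 <= n)%N ->
  (\int[P]_w (nuclear_norm (acc_noise k w))%:E <=
   (9 / 4 * ((minn m n)%:R `^ ((p - 1) / p) * sigma
      * (1 - beta) `^ ((p - 1) / p)))%:E)%E.
Proof.
move=> beta1 m1 n1; pose r : R := (minn m n)%:R; pose al := 1 - beta.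
have r0 : 0 < r by rewrite ltr0n leq_min m1.
have al0 : 0 < al by rewrite subr_gt0.
have p0 : 0 < p by rewrite (lt_trans ltr01).
pose s := al `^ ((p - 1) / p); have s0 : 0 < s by exact: powR_gt0.
pose a := r `^ (p^-1) / (sigma * s).
have a0 : 0 < a by rewrite divr_gt0 ?mulr_gt0 ?powR_gt0.
have rk : r / r `^ p^-1 = r `^ ((p - 1) / p).
  rewrite (_ : (p - 1) / p = 1 - p^-1); last by field; rewrite gt_eqF.
  by rewrite powRB ?powRr1 ?(ltW r0)// (gt_eqF r0) implybT.
have bias : r / (4 * a) = 1 / 4 * (r `^ ((p - 1) / p) * sigma * s).
  rewrite -rk /a; field.
  by rewrite !gt_eqF// powR_gt0.
have ra : a `^ (p - 1) * (al `^ (p - 1) * sigma `^ p) =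
    r `^ ((p - 1) / p) * sigma * s.
  rewrite /a powRM ?powR_ge0 ?invr_ge0 ?(ltW (mulr_gt0 sigma0 s0))//.
  rewrite -(powR_inv1 (ltW (mulr_gt0 sigma0 s0))) -(powRrM (sigma * s)) mulN1r powRN.
  rewrite powRM ?(ltW sigma0) ?(ltW s0)// -(powRrM r) (mulrC p^-1).
  rewrite -(mulr_powRB1 (ltW sigma0) p0).
  have -> : al `^ (p - 1) = s * s `^ (p - 1).
    rewrite (mulr_powRB1 (ltW s0) p0) /s -powRrM; congr (_ `^ _).
    by rewrite mulfVK// gt_eqF.
  by field; rewrite !gt_eqF// powR_gt0.
have mN : measurable_fun [set: Omega] (acc_noise k).
  exact: (measurable_past_space mxi (@measurable_acc_noise k)).
have step w : ((nuclear_norm (acc_noise k w))%:E <=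
    (smoothed_nuclear_norm a (acc_noise k w))%:E + (r / (4 * a))%:E)%E.
  by rewrite -EFinD lee_fin nuclear_le_smoothed.
have ra0 : 0 <= r / (4 * a).
  by apply: divr_ge0; [exact: ltW|apply: mulr_ge0 => //; exact: ltW].
have mh : measurable_fun [set: Omega]
    (fun w => (smoothed_nuclear_norm a (acc_noise k w))%:E).
  apply/measurable_EFinP.
  exact: (measurableT_comp (@measurable_smoothed R m n a a0) mN).
apply: le_trans (ge0_le_integral _ _ _ _ _ (fun w _ => step w)) _ => //.
- by move=> w _; rewrite lee_fin nuclear_norm_ge0.
- apply/measurable_EFinP.
  exact: (measurableT_comp (@measurable_nuclear_norm R m n) mN).
- by apply: emeasurable_funD => //; exact: measurable_cst.
rewrite ge0_integralD//; last first.
  by move=> w _; rewrite lee_fin smoothed_ge0.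
rewrite integral_probability_cst.
apply: le_trans (leeD2r _ (acc_noise_smoothed a0 k)) _.
rewrite -EFinD lee_fin -mulrA ra bias -/r -/s.
by rewrite le_eqVlt; apply/orP; left; apply/eqP; field.
Qed.

End NoiseAccumulation.

(** * Balancing the rates *)

Section Rates.
Variable R : realType.
Variables (p Delta L sigma T r : R).
Hypotheses (p1 : 1 < p) (Delta0 : 0 < Delta) (L0 : 0 < L) (sigma0 : 0 < sigma).
Hypotheses (T1 : 1 <= T) (r1 : 1 <= r).

Let kappa := r `^ ((p - 1) / p).
Let A := (Delta * L / (sigma ^+ 2 * kappa ^+ 2 * T)) `^ (p / (3 * p - 2)).
Let B := T `^ (- (p / (2 * p - 1))).
Let S2 := (r * (Delta * L * sigma `^ (p / (p - 1)) / T)) `^ ((p - 1) / (3 * p - 2)).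
Let S3 := kappa * sigma / T `^ ((p - 1) / (2 * p - 1)).

Let T0 : 0 < T. Proof. exact: lt_le_trans ltr01 T1. Qed.
Let r0 : 0 < r. Proof. exact: lt_le_trans ltr01 r1. Qed.
Let p0 : p != 0. Proof. by move: p1 => h; rewrite gt_eqF//; lra. Qed.
Let pB1 : p - 1 != 0. Proof. by move: p1 => h; rewrite gt_eqF//; lra. Qed.
Let p32 : 3 * p - 2 != 0. Proof. by move: p1 => h; rewrite gt_eqF//; lra. Qed.
Let p21 : 2 * p - 1 != 0. Proof. by move: p1 => h; rewrite gt_eqF//; lra. Qed.
Let kappa0 : 0 < kappa. Proof. exact: powR_gt0. Qed.
Let ratio0 : 0 < Delta * L / (sigma ^+ 2 * kappa ^+ 2 * T).
Proof. by rewrite divr_gt0 ?mulr_gt0 ?exprn_gt0. Qed.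
Let A0 : 0 < A. Proof. exact: powR_gt0. Qed.
Let B0 : 0 < B. Proof. exact: powR_gt0. Qed.
Let base0 : 0 < r * (Delta * L * sigma `^ (p / (p - 1)) / T).
Proof. by rewrite !(mulr_gt0, invr_gt0, powR_gt0). Qed.
Let S20 : 0 < S2. Proof. exact: powR_gt0. Qed.
Let S30 : 0 < S3. Proof. by rewrite !(mulr_gt0, invr_gt0, powR_gt0). Qed.

(** The balancing identities between monomials are checked on logarithms, where
    they are linear. *)
Let ln_eq (x y : R) : 0 < x -> 0 < y -> ln x = ln y -> x = y.
Proof. by move=> x0 y0; apply: ln_inj; rewrite posrE. Qed.

Let lnA : ln A = p / (3 * p - 2) *
  (ln Delta + ln L - (2 * ln sigma + 2 * ((p - 1) / p * ln r) + ln T)).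
Proof.
rewrite /A ln_powR ln_div ?posrE ?mulr_gt0 ?exprn_gt0//.
rewrite !lnM ?posrE ?mulr_gt0 ?exprn_gt0// /kappa ln_powR.
by congr (_ * _); ring.
Qed.

Let lnB : ln B = - (p / (2 * p - 1)) * ln T.
Proof. exact: ln_powR. Qed.

Let lnS2 : ln S2 = (p - 1) / (3 * p - 2) *
  (ln r + (ln Delta + ln L + p / (p - 1) * ln sigma - ln T)).
Proof.
rewrite /S2 ln_powR lnM ?posrE//; last first.
  by rewrite !(mulr_gt0, invr_gt0, powR_gt0).
rewrite ln_div ?posrE ?mulr_gt0 ?powR_gt0//.
by rewrite !lnM ?posrE ?mulr_gt0 ?powR_gt0// ln_powR.
Qed.

Let lnS3 : ln S3 = (p - 1) / p * ln r + ln sigma - (p - 1) / (2 * p - 1) * ln T.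
Proof.
rewrite /S3 ln_div ?posrE ?mulr_gt0 ?powR_gt0// lnM ?posrE//.
by rewrite /kappa !ln_powR.
Qed.

Let sqrt_over_A : Num.sqrt (Delta * L / T / A) = S2.
Proof.
have x0 : 0 < Delta * L / T / A by rewrite !divr_gt0 ?mulr_gt0.
rewrite -powR12_sqrt ?ltW//; apply: ln_eq => //; first exact: powR_gt0.
rewrite ln_powR lnS2 ln_div ?posrE ?divr_gt0 ?mulr_gt0// ln_div ?posrE ?mulr_gt0//.
by rewrite lnM ?posrE// lnA; field; rewrite p0 pB1 p32.
Qed.

Let bias_A : kappa * sigma * A `^ ((p - 1) / p) = S2.
Proof.
apply: ln_eq => //; first by rewrite !mulr_gt0 ?powR_gt0.
rewrite !lnM ?posrE ?mulr_gt0 ?powR_gt0// [ln (A `^ _)]ln_powR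
  [ln kappa]ln_powR lnA lnS2.
by field; rewrite p0 pB1 p32.
Qed.

Let bias_B : kappa * sigma * B `^ ((p - 1) / p) = S3.
Proof.
apply: ln_eq => //; first by rewrite !mulr_gt0 ?powR_gt0.
rewrite [LHS]lnM ?posrE ?mulr_gt0 ?powR_gt0// [ln (kappa * sigma)]lnM ?posrE//.
rewrite [ln (B `^ _)]ln_powR
  [ln kappa]ln_powR lnB lnS3.
by field; rewrite p0 p21.
Qed.

Let burnin_B : kappa * sigma / (T * B) = S3.
Proof.
apply: ln_eq => //; first by rewrite !divr_gt0 ?mulr_gt0.
rewrite [LHS]ln_div ?posrE ?mulr_gt0// [ln (kappa * sigma)]lnM ?posrE//.
rewrite [ln (T * B)]lnM ?posrE// [ln kappa]ln_powR lnB lnS3.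
by field; rewrite p0 p21.
Qed.

Let B1 : B <= 1.
Proof.
rewrite -(powRr0 T) ler_powR// oppr_le0 divr_ge0//; move: p1; lra.
Qed.

Let kappa1 : 1 <= kappa.
Proof.
rewrite -(powRr0 r) ler_powR// divr_ge0//; move: p1; lra.
Qed.

Definition momentum_rate : R := Num.min 1 (Num.max A B).
Local Notation al := momentum_rate.

Lemma momentum_rate_gt0 : 0 < al.
Proof. by rewrite lt_min ltr01 lt_max A0. Qed.

Lemma momentum_rate_le1 : al <= 1.
Proof. by rewrite ge_min lexx. Qed.

(** At [al = A] the first and the third term are of the order of [S2]
    ([sqrt_over_A], [bias_A]); at [al = B] the second and the third are at most
    of the order of [S3] ([burnin_B], [bias_B]). The cap at [1] is what brings in
    [Num.sqrt (Delta * L / T)]. *)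
Lemma balanced_rate :
  3 * Num.sqrt (Delta * L / T / al) + 2 * (sigma / (T * al))
    + 9 / 2 * (kappa * sigma * al `^ ((p - 1) / p)) <=
  9 * Num.sqrt (Delta * L / T) + 14 * S2 + 10 * S3.
Proof.
have al0 := momentum_rate_gt0.
have D0 : 0 < Delta * L / T by rewrite divr_gt0 ?mulr_gt0.
have opt : Num.sqrt (Delta * L / T / al) <= Num.sqrt (Delta * L / T) + S2.
  rewrite /al; have [h|h] := leP 1 (Num.max A B).
    by rewrite divr1 lerDl ltW.
  rewrite (@le_trans _ _ S2) ?lerDr ?sqrtr_ge0// -sqrt_over_A ler_wsqrtr//.
  rewrite ler_wpM2l ?(ltW D0)// lef_pV2 ?posrE ?lt_max ?A0//.
  by rewrite le_max lexx.
have burn : sigma / (T * al) <= S3.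
  have Bal : B <= al by rewrite /al le_min B1 le_max lexx orbT.
  rewrite -burnin_B ler_pM ?invr_ge0 ?mulr_ge0 ?(ltW sigma0) ?(ltW T0) ?(ltW al0)//.
    by rewrite ler_peMl// ltW.
  by rewrite lef_pV2 ?posrE ?mulr_gt0// ler_wpM2l// ltW.
have bias : kappa * sigma * al `^ ((p - 1) / p) <= S2 + S3.
  have e0 : 0 <= (p - 1) / p by rewrite divr_ge0//; move: p1; lra.
  have ks : 0 <= kappa * sigma by rewrite mulr_ge0 ?ltW.
  have mono : al `^ ((p - 1) / p) <= (Num.max A B) `^ ((p - 1) / p).
    rewrite ge0_ler_powR ?nnegrE ?(ltW al0)//.
      by rewrite le_max (ltW A0).
    by rewrite /al ge_min lexx orbT.
  rewrite (le_trans (ler_wpM2l ks mono))//.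
  by have [_|_] := leP A B; [rewrite bias_B lerDr|rewrite bias_A lerDl]; exact: ltW.
move: opt burn bias (sqrtr_ge0 (Delta * L / T)) (ltW S20) (ltW S30).
move: (Num.sqrt (Delta * L / T)) (Num.sqrt _) (sigma / _) (_ * al `^ _) S2 S3.
by move=> a b c d' s2 s3; lra.
Qed.

End Rates.

(** * The convergence rate *)

Lemma integral_sum_ord (R : realType) d (T : measurableType d)
    (mu : {measure set T -> \bar R}) (N : nat) (f : nat -> T -> R) :
  (forall k, measurable_fun [set: T] (f k)) -> (forall k w, 0 <= f k w) ->
  (\int[mu]_w (\sum_(k < N) f k w)%:E = \sum_(k < N) \int[mu]_w (f k w)%:E)%E.
Proof.
move=> mf f0; under eq_integral do rewrite -sumEFin.
rewrite ge0_integral_sum// => k.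
  exact/measurable_EFinP.
by move=> w _; rewrite lee_fin.
Qed.

Lemma geometric_sum_le (R : realType) (b : R) (N : nat) : 0 <= b < 1 ->
  \sum_(k < N) b ^+ k <= (1 - b)^-1.
Proof.
move=> /andP[b0 b1]; rewrite -div1r ler_pdivlMr ?subr_gt0// mulrC.
by rewrite -opprB mulNr -subrX1 opprB gerBl exprn_ge0.
Qed.

Theorem mainTheorem3 (R : realType) (m n : nat) (hm : (1 <= m)%N)
    (hn : (1 <= n)%N) (p : R) (hp1 : 1 < p) (hp2 : p <= 2)
    (dO dX : measure_display) (Omega : measurableType dO)
    (Xi : measurableType dX) (P : probability Omega R)
    (F : 'M[R]_(m, n) -> R) (g : 'M[R]_(m, n) -> Xi -> 'M[R]_(m, n))
    (x1 : 'M[R]_(m, n)) (Delta1 L sigma : R) (hL : 0 < L) (hsigma : 0 < sigma)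
    (hF : forall y : 'M[R]_(m, n), differentiable F y)
    (hDelta1 : ((F x1)%:E - ereal_inf (range (fun y => (F y)%:E))
                <= Delta1%:E)%E)
    (hLip : forall y z,
       nuclear_norm (grad F y - grad F z) <= L * spectral_norm (y - z))
    (hg : measurable_fun [set: 'M[R]_(m, n) * Xi] (fun z => g z.1 z.2))
    (xi0 : {RV P >-> Xi})
    (hmean : forall y i j,
       ('E_P[fun w => g y (xi0 w) i j] = (grad F y i j)%:E)%E)
    (hnoise : forall y,
       ('E_P[fun w => (nuclear_norm (g y (xi0 w) - grad F y) `^ p)%R]
        <= (sigma `^ p)%R%:E)%E)
    (xi : nat -> {RV P >-> Xi})
    (hxi_law : forall t, (1 <= t)%N ->
       forall B, measurable B -> distribution P (xi t) B = distribution P xi0 B)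
    (hxi_indep : mutually_independent [set t | (1 <= t)%N] xi)
    (T : nat) (hT : (1 <= T)%N) (x mom d : nat -> Omega -> 'M[R]_(m, n)) :
  let r : R := (minn m n)%:R in
  let kappa := r `^ ((p - 1) / p) in
  let beta := 1 - Num.min 1 (Num.max
       ((Delta1 * L / (sigma ^+ 2 * kappa ^+ 2 * T%:R)) `^ (p / (3 * p - 2)))
       (T%:R `^ (- (p / (2 * p - 1))))) in
  let eta := Num.sqrt (Delta1 * (1 - beta) / (L * T%:R)) in
  (forall w, muon_run g x1 (fun=> eta) (fun=> beta) (fun t => xi t w)
               (fun t => x t w) (fun t => mom t w) (fun t => d t w)) ->
  (forall t, (1 <= t)%N -> forall B, measurable B ->
     history (fun t => xi t : Omega -> Xi) t (d t @^-1` B)) ->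
  ((T%:R^-1)%R%:E * \sum_(1 <= t < T.+1) 'E_P[fun w => nuclear_norm (grad F (x t w))]
   <= (9 * Num.sqrt (Delta1 * L / T%:R)
       + 14 * (r * (Delta1 * L * sigma `^ (p / (p - 1)) / T%:R))
                `^ ((p - 1) / (3 * p - 2))
       + 10 * (r `^ ((p - 1) / p) * sigma / T%:R `^ ((p - 1) / (2 * p - 1))))%R%:E)%E.
Proof.
move=> r kappa beta eta hrun hadapt.
pose al := momentum_rate p Delta1 L sigma T%:R r.
have bE : beta = 1 - al by [].
move: (beta) bE @eta hrun => {}beta bE eta hrun.
have r1 : 1 <= r by rewrite ler1n leq_min hm.
have T1 : 1 <= T%:R :> R by rewrite ler1n.
have T0 : 0 < T%:R :> R by rewrite ltr0n.
have hD y : F x1 - F y <= Delta1.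
  rewrite -lee_fin EFinB; apply: le_trans hDelta1; apply: leeB => //.
  by apply: ereal_inf_lbound; exists y.
have D0 : 0 <= Delta1 by have := hD x1; rewrite subrr.
have -> : (\sum_(1 <= t < T.+1) 'E_P[fun w => nuclear_norm (grad F (x t w))] =
    \sum_(k < T) \int[P]_w (nuclear_norm (grad F (x k.+1 w)))%:E)%E.
  by rewrite big_add1 big_mkord; apply: eq_bigr => k _; rewrite unlock.
(* For [Delta1 = 0] the stepsize is zero and [x1] is a minimiser. *)
have [D1|D1] := eqVneq Delta1 0.
  have eta0 : eta = 0 by rewrite /eta D1 !mul0r sqrtr0.
  have xx1 k w : x k.+1 w = x1.
    elim: k => [|k IH]; first exact: muon_x1 (hrun w).
    by rewrite (muon_x (hrun w) (ltn0Sn k)) IH eta0 scale0r addr0.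
  rewrite big1 => [|k _].
    rewrite mule0 lee_fin !addr_ge0 ?mulr_ge0 ?sqrtr_ge0 ?powR_ge0 ?invr_ge0
      ?(ltW hsigma) ?powR_ge0//.
  rewrite (_ : (fun w => _) = (fun=> 0%:E)) ?integral_probability_cst//.
  apply/funext => w; rewrite xx1 (grad_eq0_at_min hF (ltW hL) hLip)// => y.
  by have := hD y; rewrite D1 subr_le0.
have {}D0 : 0 < Delta1 by rewrite lt0r D1.
have al0 : 0 < al by exact: momentum_rate_gt0.
have al1 : al <= 1 by exact: momentum_rate_le1.
have beta0 : 0 <= beta by rewrite bE subr_ge0.
have beta1 : beta < 1 by rewrite bE gtrBl.
have alE : 1 - beta = al by rewrite bE subKr.
have eta0 : 0 < eta.
  by rewrite sqrtr_gt0 alE divr_gt0 ?mulr_gt0.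
have beta01 : 0 <= beta < 1 by rewrite beta0.
have beta01' : 0 <= beta <= 1 by rewrite beta0 ltW.
have hx1 w : x 1%N w = x1 by exact: muon_x1 (hrun w).
have hx t (t1 : (1 <= t)%N) w : x t.+1 w = x t w + eta *: d t w.
  exact: muon_x (hrun w) _ t1.
pose eps1 w := nuclear_norm (sample_noise F g xi x 1 w).
pose N k w := nuclear_norm (acc_noise F g xi beta x k w).
pose K := Delta1 / eta + T%:R * (L * eta / 2 + 2 * (L * eta * beta / (1 - beta))).
have path w : \sum_(k < T) nuclear_norm (grad F (x k.+1 w)) <=
    K + \sum_(k < T) 2 * (beta ^+ k * eps1 w + N k w).
  exact: (muon_path_bound hF (ltW hL) hLip (ltW eta0) beta01 (hrun w)).
have mN k : measurable_fun [set: Omega] (acc_noise F g xi beta x k).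
  apply: measurable_past_space (@measurable_acc_noise _ _ _ _ _ _ _ P F g L
    (ltW hL) hLip hg xi x1 eta beta x d hx1 hx hadapt k) => t.
  exact: measurable_funP.
have me : measurable_fun [set: Omega] (sample_noise F g xi x 1).
  apply: measurable_past_space (@measurable_sample_noise _ _ _ _ _ _ _ P F g L
    (ltW hL) hLip hg xi x1 eta x d hx1 hx hadapt 0) => t.
  exact: measurable_funP.
have mx k : measurable_fun [set: Omega] (x k.+1).
  apply: measurable_past_space (@measurable_iterate _ _ _ _ _ _ _ P xi
    x1 eta x d hx1 hx hadapt k) => t.
  exact: measurable_funP.
have mnuc (f : Omega -> 'M[R]_(m, n)) : measurable_fun [set: Omega] f ->
    measurable_fun [set: Omega] (fun w => nuclear_norm (f w)).
  by move=> mf; exact: (measurableT_comp (@measurable_nuclear_norm R m n) mf).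
have mG k : measurable_fun [set: Omega] (fun w => nuclear_norm (grad F (x k.+1 w))).
  apply: mnuc; apply: (measurableT_comp _ (mx k)).
  exact: measurable_grad (ltW hL) hLip.
have Eeps : (\int[P]_w (eps1 w)%:E <= sigma%:E)%E.
  exact: (initial_noise_le hp1 hsigma hg hnoise hxi_law hx1).
pose V := 9 / 4 * (kappa * sigma * al `^ ((p - 1) / p)).
have EN k : (\int[P]_w (N k w)%:E <= V%:E)%E.
  rewrite /V -alE.
  exact: (acc_noise_le hp1 hp2 (ltW hL) hsigma hLip hg hmean hnoise hxi_law
    hxi_indep beta01' hx1 hx hadapt k beta1 hm hn).
have K0 : 0 <= K.
  rewrite /K alE !(addr_ge0, mulr_ge0, invr_ge0) ?(ltW T0) ?(ltW hL) ?(ltW eta0)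
    ?(ltW D0) ?(ltW al0)//.
have mB k : measurable_fun [set: Omega] (fun w => 2 * (beta ^+ k * eps1 w + N k w)).
  apply: measurable_funM => //; apply: measurable_funD; last exact: mnuc.
  by apply: measurable_funM => //; exact: mnuc.
have B0 k w : 0 <= 2 * (beta ^+ k * eps1 w + N k w).
  by rewrite mulr_ge0// addr_ge0 ?mulr_ge0 ?exprn_ge0 ?nuclear_norm_ge0.
have EB k : (\int[P]_w (2 * (beta ^+ k * eps1 w + N k w))%:E <=
    (2 * (beta ^+ k * sigma + V))%:E)%E.
  have -> : (\int[P]_w (2 * (beta ^+ k * eps1 w + N k w))%:E =
     2%:E * ((beta ^+ k)%:E * \int[P]_w (eps1 w)%:E + \int[P]_w (N k w)%:E))%E.
    transitivity (\int[P]_w (2%:E * ((beta ^+ k)%:E * (eps1 w)%:E + (N k w)%:E)))%E.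
      exact: eq_integral.
    have me1 : measurable_fun [set: Omega] (fun w => (eps1 w)%:E).
      by apply/measurable_EFinP; exact: mnuc.
    have mN1 : measurable_fun [set: Omega] (fun w => (N k w)%:E).
      by apply/measurable_EFinP; exact: mnuc.
    have e0 w : (0 <= (eps1 w)%:E)%E by rewrite lee_fin nuclear_norm_ge0.
    have n0 w : (0 <= (N k w)%:E)%E by rewrite lee_fin nuclear_norm_ge0.
    have b0 : (0 <= (beta ^+ k)%:E)%E by rewrite lee_fin exprn_ge0.
    have mbe : measurable_fun [set: Omega] (fun w => (beta ^+ k)%:E * (eps1 w)%:E)%E.
      exact: measurable_funeM.
    have be0 w : (0 <= (beta ^+ k)%:E * (eps1 w)%:E)%E by rewrite mule_ge0.
    rewrite ge0_integralZl//; last 2 first.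
    - exact: emeasurable_funD.
    - by move=> w _; rewrite adde_ge0.
    by rewrite ge0_integralD// ge0_integralZl.
  rewrite [leRHS]EFinM lee_wpmul2l ?lee_fin// EFinD leeD// EFinM.
  by rewrite lee_wpmul2l// lee_fin exprn_ge0.
have Etot : (\sum_(k < T) \int[P]_w (nuclear_norm (grad F (x k.+1 w)))%:E <=
    (K + \sum_(k < T) 2 * (beta ^+ k * sigma + V))%:E)%E.
  rewrite -(integral_sum_ord P T mG); last by move=> k w; exact: nuclear_norm_ge0.
  have path' w : ((\sum_(k < T) nuclear_norm (grad F (x k.+1 w)))%:E <=
      K%:E + (\sum_(k < T) 2 * (beta ^+ k * eps1 w + N k w))%:E)%E.
    by rewrite -EFinD lee_fin.
  have mS (f : nat -> Omega -> R) : (forall k, measurable_fun [set: Omega] (f k)) ->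
      measurable_fun [set: Omega] (fun w => (\sum_(k < T) f k w)%:E).
    move=> mf; apply/measurable_EFinP.
    exact: (@measurable_sum _ _ _ _ _ _ (fun k : 'I_T => f k)).
  apply: le_trans (ge0_le_integral _ _ _ _ _ (fun w _ => path' w)) _ => //.
  - by move=> w _; rewrite lee_fin sumr_ge0// => k _; exact: nuclear_norm_ge0.
  - exact: (mS (fun k w => nuclear_norm (grad F (x k.+1 w)))).
  - apply: emeasurable_funD; first exact: measurable_cst.
    exact: (mS (fun k w => 2 * (beta ^+ k * eps1 w + N k w))).
  rewrite ge0_integralD//; last 2 first.
  - by move=> w _; rewrite lee_fin sumr_ge0.
  - exact: (mS (fun k w => 2 * (beta ^+ k * eps1 w + N k w))).
  rewrite integral_probability_cst [leRHS]EFinD leeD2l//.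
  rewrite (integral_sum_ord P T mB B0) -sumEFin.
  by apply: lee_sum => k _.
apply: le_trans (lee_wpmul2l _ Etot) _; first by rewrite lee_fin invr_ge0 ltW.
rewrite -EFinM lee_fin.
apply: le_trans (balanced_rate hp1 D0 hL hsigma T1 r1).
rewrite -/al -/kappa.
(* [q] is the common value of [L * eta / al] and [Delta1 / (eta * T)]. *)
pose q := Num.sqrt (Delta1 * L / T%:R / al).
have q0 : 0 < q by rewrite sqrtr_gt0 !divr_gt0 ?mulr_gt0.
have q2 : q ^+ 2 = Delta1 * L / T%:R / al.
  by rewrite sqr_sqrtr// !divr_ge0 ?mulr_ge0 ?(ltW D0) ?(ltW hL) ?(ltW T0) ?(ltW al0).
have etaE : eta = q * al / L.
  rewrite /eta alE (_ : _ / _ = (q * al / L) ^+ 2); last first.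
    by rewrite expr_div_n exprMn q2; field; rewrite !gt_eqF.
  by rewrite sqrtr_sqr ger0_norm// ltW// divr_gt0 ?mulr_gt0.
have KE : T%:R^-1 * K <= 3 * q.
  have -> : T%:R^-1 * K = (Delta1 * L / T%:R / al) / q + q * al / 2 + 2 * q * beta.
    by rewrite /K alE etaE; field; rewrite !gt_eqF.
  have -> : (Delta1 * L / T%:R / al) / q = q.
    by rewrite -q2 expr2 mulfK// gt_eqF.
  have : 0 <= q * al by rewrite mulr_ge0 ?ltW.
  by rewrite bE; move: q0; lra.
have SE : T%:R^-1 * \sum_(k < T) 2 * (beta ^+ k * sigma + V) <=
    2 * (sigma / (T%:R * al)) + 2 * V.
  rewrite -mulr_sumr big_split /= -mulr_suml sumr_const card_ord -[V *+ T]mulr_natl.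
    have -> : T%:R^-1 * (2 * ((\sum_(k < T) beta ^+ k) * sigma + T%:R * V)) =
      2 * (sigma / T%:R * \sum_(k < T) beta ^+ k) + 2 * V.
    by field; rewrite gt_eqF.
  have -> : sigma / (T%:R * al) = sigma / T%:R * al^-1.
    by field; rewrite !gt_eqF.
  rewrite lerD2r; apply: ler_wpM2l => //; apply: ler_wpM2l.
    by apply: divr_ge0; exact: ltW.
  by rewrite -alE; exact: geometric_sum_le.
rewrite mulrDr (le_trans (lerD KE SE))// -/q /V.
by move: (kappa * _ * _) => b; lra.
Qed.
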